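(* Let $-\frac12<\nu\le\frac12$. Then for all $x>0$ and $\tau>0$, $$|K_{i\tau}(x)|\le\frac{\Gamma(\nu+1/2)}{\Gamma(\nu+1)}\,\bigl|\Gamma(\nu+1+i\tau)\bigr|\,x^{-\nu-1/2}.$$
   Context: $K_{i\tau}(x)=\int_0^\infty e^{-x\cosh t}\cos(\tau t)\,dt$ ($x>0$) is the Macdonald function (modified Bessel function of the second kind) of imaginary index; $\Gamma$ is the Euler gamma function. *)

(* Defs.v *)
From HB Require Import structures.
From mathcomp Require Import all_boot all_order all_algebra.
From mathcomp Require Import all_classical all_reals all_analysis.
From mathcomp Require Import complex.

Set Implicit Arguments.
Unset Strict Implicit.
Unset Printing Implicit Defensive.

Import Order.TTheory GRing.Theory Num.Theory.

Local Open Scope classical_set_scope.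
Local Open Scope ring_scope.
Local Open Scope complex_scope.

Definition cosh {R : realType} (t : R) : R := (expR t + expR (- t)) / 2.

(* [macdonaldKi tau x] is K_{i tau}(x), for x > 0. The integrand is dominated
   by expR (- x * cosh t), so the Lebesgue integral converges absolutely. *)
Definition macdonaldKi {R : realType} (tau x : R) : R :=
  \int[lebesgue_measure]_(t in `[0, +oo[) (expR (- x * cosh t) * cos (tau * t)).

(* t ^ z = exp (z ln t) for t > 0, using the real logarithm of t; the value at
   t <= 0 is irrelevant below. *)
Definition cpowR {R : realType} (t : R) (z : R[i]) : R[i] :=
  let r := t `^ complex.Re z in
  let theta := complex.Im z * ln t in
  (r * cos theta) +i* (r * sin theta).

(* Euler's integral of the second kind, for real a > 0 and for complex z with
   Re z > 0 respectively. Outside these half-line and half-plane the integrals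
   diverge and these are not the analytic continuation of Gamma. *)
Definition Gamma {R : realType} (a : R) : R :=
  \int[lebesgue_measure]_(t in `]0, +oo[) (t `^ (a - 1) * expR (- t)).

Definition cGamma {R : realType} (z : R[i]) : R[i] :=
  let f (t : R) : R[i] := cpowR t (z - 1) * (expR (- t))%:C in
  (\int[lebesgue_measure]_(t in `]0, +oo[) complex.Re (f t)) +i*
  (\int[lebesgue_measure]_(t in `]0, +oo[) complex.Im (f t)).

Lemma cGamma_real (R : realType) (a : R) : cGamma a%:C = (Gamma a)%:C.
Proof.
rewrite /cGamma /Gamma; congr (_ +i* _).
  apply: eq_Rintegral => t _ /=.
  by rewrite subrr mul0r cos0 sin0 mulr1 !mulr0 subr0.
rewrite /Rintegral integral0_eq //= => t _.
by rewrite subrr mul0r sin0 !mulr0 mul0r addr0.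
Qed.

(* Main.v *)
Require Import Defs.
From mathcomp Require Import all_boot all_order all_algebra.
From mathcomp Require Import all_classical all_reals all_analysis.
From mathcomp Require Import measurable_realfun complex.
From mathcomp Require Import ring lra.

Import Order.TTheory GRing.Theory Num.Theory.
Import numFieldNormedType.Exports.

Local Open Scope ring_scope.
Local Open Scope complex_scope.
Local Open Scope classical_set_scope.

(** The starting point is Hankel's formula
      [K_{i tau}(x) = 2^(nu + i tau) Gamma(nu + 1 + i tau) x^(- nu - i tau)
        * int_0^oo J_nu(x r) r^(nu + 1) (1 + r^2)^(- nu - 1 - i tau) dr],
    combined with [|J_nu(y)| <= (2 / (pi y))^(1/2), which holds for |nu| <= 1/2].
    With [a = nu + 1/2] and [s = r^2], Poisson's integral replaces the Bessel
    function by [osc a x s = int_0^(sqrt s) (s - p^2)^(a - 1) cos (x p) dp].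
    - Its Laplace transform is elementary: exchanging the integrals leaves a
      Gamma integral in [s] and a Gaussian cosine integral in [p].  A Mellin
      integral against [u^(a - 1/2 + i tau) exp(-u)] then yields [K_{i tau}(x)].
    - Its size is found by moving the contour of [e^(i x z) (r^2 - z^2)^(a - 1)]
      to a vertical half-line, where [|e^(i x z)|] decays and the remaining
      factor is at most [(2 r y)^(a - 1)] because [a <= 1].
    What is left is the Beta integral
      [int_0^oo s^((a - 1) / 2) (1 + s)^(- a - 1/2) ds]. *)

(** * Lebesgue integrals under translation, reflection and increasing substitution *)

Section change_of_variables.
Context {R : realType}.
Notation mu := (@lebesgue_measure R).
Local Open Scope ereal_scope.

(** Two estimates must not be made too early. Bounding cos (x p) by 1 inside [osc] gives the size
    s^(a - 1/2), against which (1 + s)^(- a - 1/2) leaves a logarithmically divergent integral and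
    no decay in x; moving the contour gives s^((a - 1) / 2) x^(- a) instead. Bounding the
    oscillation in tau before the Mellin integral is computed gives Gamma(b), with b = a + 1/2 = nu
    + 1, in place of |Gamma(b + i tau)|. So for each fixed s the u-integral is evaluated exactly:
    exp(- u) and exp(- u s) merge into the rate 1 + s, and the result is (1 + s)^(- b) times the
    real part of a unimodular multiple of Gamma(b + i tau). The constants then fit: the contour
    gives 2^(a - 1) Gamma(a) x^(- a), the Beta integral 2^(1 - a) sqrt(pi) Gamma(a) / Gamma(b), and
    the identity for K_{i tau}(x) carries the factor sqrt(pi) Gamma(a). Integrals over the positive
    half-line are mostly taken over the real line by u = exp t; scaling becomes translation, which
    is why rates are often written [expR g]. *)

Lemma lebesgue_measureD (b : R) (A : set R) : measurable A ->
  pushforward mu ((fun x => x + b)%R : _ -> measurableTypeR R) A = mu A.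
Proof.
move=> mA; apply/esym/lebesgue_measure_unique => //=.
  exact: measurable_funD.
move=> _ _ [[c d] _ <-]; rewrite /pushforward (_ : _ @^-1` _ = `](c - b)%R, (d - b)%R]%classic).
  rewrite !lebesgue_measure_itv/= !lte_fin ltrD2r; case: ifPn => // _.
  by rewrite -!EFinB opprB addrA subrK.
apply/seteqP; split => x /=; rewrite !in_itv/= => /andP[? ?]; apply/andP; split; lra.
Qed.

Lemma ge0_integral_shift (b : R) (f : R -> \bar R) :
  measurable_fun [set: R] f -> (forall x, 0 <= f x) ->
  \int[mu]_x f (x + b)%R = \int[mu]_x f x.
Proof.
move=> mf f0.
transitivity (\int[pushforward mu ((fun x => x + b)%R : _ -> measurableTypeR R)]_x f x).
  rewrite ge0_integral_pushforward//=; exact: measurable_funD.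
apply: eq_measure_integral => [|? A mA _]; first exact: measurable_funD.
exact: lebesgue_measureD.
Qed.

Lemma ge0_integral_opp (f : R -> \bar R) :
  measurable_fun [set: R] f -> (forall x, 0 <= f x) ->
  \int[mu]_x f (- x)%R = \int[mu]_x f x.
Proof.
move=> mf f0.
transitivity (\int[pushforward mu (-%R : _ -> measurableTypeR R)]_x f x).
  rewrite ge0_integral_pushforward//=.
apply: eq_measure_integral => A mA _; exact: lebesgue_measureN.
Qed.

(** The positive and negative parts are translated separately as extended integrals, so the identity
    also covers functions that are not integrable. *)
Lemma Rintegral_shift (b : R) (f : R -> R) :
  measurable_fun [set: R] f ->
  (\int[mu]_x f (x + b) = \int[mu]_x f x)%R.
Proof.
move=> mf; rewrite /Rintegral integralE [in RHS]integralE; congr (fine (_ - _)).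
  rewrite -(ge0_integral_shift b (fun x => (f x)%:E)^\+)//;
    first by apply: eq_integral => x _; rewrite ?funeposE ?funenegE.
  exact/measurable_funepos/measurable_EFinP.
rewrite -(ge0_integral_shift b (fun x => (f x)%:E)^\-)//;
    first by apply: eq_integral => x _; rewrite ?funeposE ?funenegE.
exact/measurable_funeneg/measurable_EFinP.
Qed.

Lemma Rintegral_opp (f : R -> R) : measurable_fun [set: R] f ->
  (\int[mu]_x f (- x) = \int[mu]_x f x)%R.
Proof.
move=> mf; rewrite /Rintegral integralE [in RHS]integralE; congr (fine (_ - _)).
  rewrite -(ge0_integral_opp (fun x => (f x)%:E)^\+)//;
    first by apply: eq_integral => x _; rewrite ?funeposE ?funenegE.
  exact/measurable_funepos/measurable_EFinP.
rewrite -(ge0_integral_opp (fun x => (f x)%:E)^\-)//;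
    first by apply: eq_integral => x _; rewrite ?funeposE ?funenegE.
exact/measurable_funeneg/measurable_EFinP.
Qed.

(** Substitution on each [[-n, n]], then monotone convergence on both sides. Describing [D] as the
    union of the image intervals serves maps onto the half-line and maps onto the line alike;
    continuity of [f] is asked at the points [phi t] because some integrands are singular at the
    boundary of [D]. *)
Lemma ge0_integral_change_of_variables (phi dphi f : R -> R) (D : set R) :
  (forall t : R, is_derive t (1%R : R) phi (dphi t)) -> continuous dphi ->
  (forall t, (0 < dphi t)%R) ->
  D = \bigcup_n `[phi (- n%:R)%R, phi n%:R]%classic ->
  (forall t, {for phi t, continuous f}) -> (forall y, D y -> (0 <= f y)%R) ->
  \int[mu]_(y in D) (f y)%:E = \int[mu]_t (f (phi t) * dphi t)%:E.
Proof.
move=> dphiE cdphi dphi0 DE cf f0.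
have dphi1 : phi^`() = dphi.
  by apply/funext => t; rewrite derive1E; exact: derive_val.
have cphi : continuous phi.
  by move=> t; apply/differentiable_continuous/derivable1_diffP; exact: ex_derive.
have incr : {homo phi : x y / (x < y)%R}.
  move=> x y xy.
  have [//|c _] := @MVT _ phi dphi x y xy (fun t _ => dphiE t).
    exact: continuous_subspaceT.
  by rewrite -subr_gt0 => ->; rewrite mulr_gt0// subr_gt0.
have le_phi : {homo phi : x y / (x <= y)%R} by apply: ltW_homo.
(* By the intermediate value theorem every point of an image interval is some [phi t], and there [f]
   is continuous. *)
have surj n y : `[phi (- n%:R)%R, phi n%:R]%classic y -> exists t, y = phi t.
  move=> /=; rewrite in_itv/= => yn.
  have [|||t _ <-] := @IVT _ phi (- n%:R)%R n%:R y.
  - by rewrite (@le_trans _ _ 0%R) ?oppr_le0.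
  - exact: continuous_subspaceT.
  - rewrite min_l ?max_r// le_phi//; by rewrite (@le_trans _ _ 0%R) ?oppr_le0.
  by exists t.
have cfn n : {within `[phi (- n%:R)%R, phi n%:R], continuous f}.
  apply: continuous_in_subspaceT => y /set_mem yn.
  by have [t ->] := surj n y yn; exact: cf.
have lhs : \int[mu]_(y in `[phi (- n%:R)%R, phi n%:R]) (f y)%:E @[n --> \oo]
    --> \int[mu]_(y in D) (f y)%:E.
  rewrite DE; apply: ge0_nondecreasing_set_cvg_integral => //.
  - apply/nondecreasing_seqP => n; rewrite subsetEset.
    by apply: subset_itv; rewrite bnd_simp; apply: le_phi; rewrite ?lerN2 ler_nat.
  - move=> n; apply/measurable_EFinP.
    by apply: subspace_continuous_measurable_fun.
  - by move=> n x xn; rewrite lee_fin f0// DE; exists n.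
have rhs : \int[mu]_(t in `[(- n%:R)%R, n%:R]) (f (phi t) * dphi t)%:E @[n --> \oo]
    --> \int[mu]_t (f (phi t) * dphi t)%:E.
  have -> : [set: R] = \bigcup_n `[(- n%:R)%R, n%:R]%classic.
    apply/seteqP; split => // x _.
    exists (Num.truncn `|x|).+1 => //=; rewrite in_itv/= -ler_norml ltW//.
    exact: truncnS_gt.
  apply: ge0_nondecreasing_set_cvg_integral => //.
  - apply/nondecreasing_seqP => n; rewrite subsetEset.
    by apply: subset_itv; rewrite bnd_simp ?lerN2 ler_nat.
  - move=> n; apply/measurable_EFinP; apply: measurable_funTS.
    apply: continuous_measurable_fun => t.
    by apply: cvgM; [exact: (@continuous_comp _ _ _ phi f t (cphi t) (cf t))|exact: cdphi].
  - move=> n t tn; rewrite lee_fin mulr_ge0//; last exact: ltW.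
    apply: f0; rewrite DE; exists n => //=; move: tn => /=.
    by rewrite !in_itv/= => /andP[? ?]; rewrite !le_phi.
rewrite -(cvg_lim _ lhs)// -(cvg_lim _ rhs)//; congr (limn _).
apply/funext => n; rewrite integration_by_substitution_increasing//.
- by apply: eq_integral => t _; rewrite dphi1.
- by rewrite (@le_trans _ _ 0%R) ?oppr_le0.
- by move=> x y _ _; exact: incr.
- by rewrite dphi1 => x _; exact: cdphi.
- apply/cvg_ex; exists (dphi (- n%:R)%R); rewrite dphi1.
  by apply: cvg_at_right_filter; exact: cdphi.
- apply/cvg_ex; exists (dphi n%:R); rewrite dphi1.
  by apply: cvg_at_left_filter; exact: cdphi.
- split.
  + by move=> x _; exact: ex_derive.
  + by apply: cvg_at_right_filter; exact: cphi.
  + by apply: cvg_at_left_filter; exact: cphi.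
Qed.

End change_of_variables.

(** * Cauchy's theorem on a rectangle, in real form *)

Section cauchy_rectangle.
Context {R : realType}.
Notation mu := (@lebesgue_measure R).

Lemma is_derive_expR_cos (l th : R -> R) (x dl dth : R) :
  is_derive x (1 : R) l dl -> is_derive x (1 : R) th dth ->
  is_derive x (1 : R) (fun x => expR (l x) * cos (th x))
    (expR (l x) * (dl * cos (th x) - dth * sin (th x))).
Proof.
move=> dlx dthx.
have h1 : is_derive x (1 : R) (expR \o l) (expR (l x) * dl) by exact: is_derive1_comp.
have h2 : is_derive x (1 : R) (cos \o th) (- sin (th x) * dth).
  exact: is_derive1_comp.
apply: (@is_derive_eq _ _ _ _ _ _ _ _ (is_deriveM h1 h2)).
by rewrite /GRing.scale/=; ring.
Qed.

Lemma is_derive_expR_sin (l th : R -> R) (x dl dth : R) :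
  is_derive x (1 : R) l dl -> is_derive x (1 : R) th dth ->
  is_derive x (1 : R) (fun x => expR (l x) * sin (th x))
    (expR (l x) * (dl * sin (th x) + dth * cos (th x))).
Proof.
move=> dlx dthx.
have h1 : is_derive x (1 : R) (expR \o l) (expR (l x) * dl) by exact: is_derive1_comp.
have h2 : is_derive x (1 : R) (sin \o th) (cos (th x) * dth).
  exact: is_derive1_comp.
apply: (@is_derive_eq _ _ _ _ _ _ _ _ (is_deriveM h1 h2)).
by rewrite /GRing.scale/=; ring.
Qed.

Lemma is_derive_continuous (f : R -> R) (x df : R) :
  is_derive x (1 : R) f df -> {for x, continuous f}.
Proof.
by move=> h; apply/differentiable_continuous/derivable1_diffP; exact: ex_derive.
Qed.

(* Real part of Cauchy's theorem for the integral of [exp (L + i T)] around the rectangle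
   [0, X] x [0, Y].  The hypotheses are the Cauchy-Riemann equations for
   [L + i T], whose complex derivative is [P + i S]. *)
Lemma cauchy_rectangle (L T P S : R -> R -> R) (al be X Y M : R) :
  al < 0 -> 0 < X -> X < be -> 0 < Y ->
  (forall r y, al < r < be -> is_derive r (1 : R) (L ^~ y) (P r y)) ->
  (forall r y, al < r < be -> is_derive y (1 : R) (T r) (P r y)) ->
  (forall r y, al < r < be -> is_derive r (1 : R) (T ^~ y) (S r y)) ->
  (forall r y, al < r < be -> is_derive y (1 : R) (L r) (- S r y)) ->
  (forall r, al < r < be -> continuous (P r)) ->
  (forall r, al < r < be -> continuous (S r)) ->
  (forall r y, al < r < be -> 0 <= y <= Y ->
    expR (L r y) * (`|S r y| + `|P r y|) <= M) ->
  (\int[mu]_(r in `[0, X]) (expR (L r 0) * cos (T r 0)) =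
   \int[mu]_(r in `[0, X]) (expR (L r Y) * cos (T r Y)) +
   \int[mu]_(y in `[0, Y]) (expR (L X y) * sin (T X y)) -
   \int[mu]_(y in `[0, Y]) (expR (L 0 y) * sin (T 0 y)))%R.
Proof.
move=> al0 X0 Xbe Y0 Lr Ty Tr Ly cP cS wM.
pose u r y := expR (L r y) * cos (T r y).
pose v r y := expR (L r y) * sin (T r y).
(* With u + i v = exp (L + i T), the Cauchy-Riemann equations make [w] both the r-derivative of [v]
   and the y-derivative of - u. *)
pose w r y := expR (L r y) * (P r y * sin (T r y) + S r y * cos (T r y)).
have vr r y : al < r < be -> is_derive r (1 : R) (v ^~ y) (w r y).
  by move=> rb; apply: is_derive_expR_sin; [exact: Lr|exact: Tr].
have uy r y : al < r < be -> is_derive y (1 : R) (fun y => - u r y) (w r y).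
  move=> rb; have := is_derive_expR_cos (L r) (T r) y _ _ (Ly r y rb) (Ty r y rb).
  move=> /is_deriveN h; apply: (is_derive_eq h); rewrite /w; ring.
have ur r y : al < r < be -> {for r, continuous (u ^~ y)}.
  move=> rb; have := is_derive_expR_cos (L ^~ y) (T ^~ y) r _ _ (Lr r y rb) (Tr r y rb).
  exact: is_derive_continuous.
have vy r : al < r < be -> continuous (v r).
  move=> rb y; have := is_derive_expR_sin (L r) (T r) y _ _ (Ly r y rb) (Ty r y rb).
  exact: is_derive_continuous.
have cw r : al < r < be -> continuous (w r).
  move=> rb y.
  have cT : {for y, continuous (T r)} := is_derive_continuous _ _ _ (Ty r y rb).
  have cL : {for y, continuous (L r)} := is_derive_continuous _ _ _ (Ly r y rb).
  rewrite /continuous_at; apply: cvgM.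
    by apply: (@continuous_comp _ _ _ (L r) expR) => //; exact: continuous_expR.
  apply: cvgD; apply: cvgM.
  - exact: cP.
  - by apply: (@continuous_comp _ _ _ (T r) sin) => //; exact: continuous_sin.
  - exact: cS.
  - by apply: (@continuous_comp _ _ _ (T r) cos) => //; exact: continuous_cos.
have FTCy r : al < r < be -> \int[mu]_(y in `[0, Y]) w r y = u r 0 - u r Y.
  move=> rb; rewrite /Rintegral (@continuous_FTC2 _ _ (fun y => - u r y))//=.
  - by rewrite opprK addrC.
  - exact/continuous_subspaceT/cw.
  - split.
    + by move=> y _; have [] := uy r y rb.
    + by apply: cvg_at_right_filter; exact: is_derive_continuous (uy r 0 rb).
    + by apply: cvg_at_left_filter; exact: is_derive_continuous (uy r Y rb).
  - by move=> y _; rewrite derive1E; have [] := uy r y rb.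
have wMM r y : al < r < be -> 0 <= y <= Y -> `|w r y| <= M.
  move=> rb yY; apply: le_trans (wM r y rb yY).
  rewrite normrM ger0_norm ?expR_ge0// ler_wpM2l ?expR_ge0//.
  rewrite (addrC `|S r y|) (le_trans (ler_normD _ _))// !normrM lerD//.
    by rewrite ler_piMr// ler_norml sin_geN1 sin_le1.
  by rewrite ler_piMr// ler_norml cos_geN1 cos_le1.
have M0 : 0 <= M.
  have h0 : al < 0 < be by rewrite al0/= (lt_trans X0).
  by apply: (le_trans (normr_ge0 _) (wMM 0 0 h0 _)); rewrite lexx ltW.
(* Differentiation under the integral sign and [FTCy] give [Psi] the derivative [u r 0 - u r Y],
   whose integral over [[0, X]] is the claim. The margins [al < 0] and [X < be] make [Psi]
   differentiable at both ends too. *)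
pose Psi r := \int[mu]_(y in `[0, Y]) v r y.
have Psid r : al < r < be -> is_derive r (1 : R) Psi (u r 0 - u r Y).
  move=> rb.
  have Ia : `]al, be[%classic r by rewrite /= in_itv.
  have intf z : `]al, be[%classic z -> mu.-integrable `[0, Y] (EFin \o v z).
    rewrite /= in_itv/= => zb.
    apply: continuous_compact_integrable; first exact: segment_compact.
    exact/continuous_subspaceT/vy.
  have derf1 z y : `]al, be[%classic z -> `[0, Y]%classic y -> derivable (v ^~ y) z 1.
    by rewrite /= !in_itv/= => zb _; have [] := vr z y zb.
  have d1 z y : al < z < be -> partial1of2 v z y = w z y.
    by move=> zb; rewrite partial1of2E; have [] := vr z y zb.
  have G_ub z y : `]al, be[%classic z -> `[0, Y]%classic y -> `|partial1of2 v z y| <= M.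
    by rewrite /= !in_itv/= => zb yY; rewrite d1// wMM.
  have intG : mu.-integrable `[0, Y] (EFin \o cst M).
    apply: continuous_compact_integrable; first exact: segment_compact.
    by apply: continuous_subspaceT => ?; exact: cvg_cst.
  apply: DeriveDef.
    by apply: (@derivable_under_integral R _ _ mu v `[0, Y] _ r al be Ia intf derf1
      (fun=> M) (fun=> M0) intG G_ub); exact: measurable_itv.
  rewrite -derive1E (@differentiation_under_integral R _ _ mu v `[0, Y] _ r al be
    Ia intf derf1 (fun=> M) (fun=> M0) intG G_ub); last exact: measurable_itv.
  by rewrite -FTCy//; apply: eq_Rintegral => y _; exact: d1.
have inX r : 0 <= r <= X -> al < r < be.
  by move=> /andP[r0 rX]; rewrite (lt_le_trans al0)//= (le_lt_trans rX).
have intu y : mu.-integrable `[0, X] (EFin \o (u ^~ y)).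
  apply: continuous_compact_integrable; first exact: segment_compact.
  by apply: continuous_in_subspaceT => r /set_mem/=; rewrite in_itv/= => /inX; exact: ur.
have : \int[mu]_(r in `[0, X]) (u r 0 - u r Y) = Psi X - Psi 0.
  rewrite /Rintegral (@continuous_FTC2 _ _ Psi)//=.
  - apply: continuous_in_subspaceT => r /set_mem/=; rewrite in_itv/= => /inX rb.
    by apply: cvgB; exact: ur.
  - split.
    + move=> r; rewrite in_itv/= => /andP[r0 rX].
      by have [] := Psid r (inX r _); rewrite // !ltW.
    + apply: cvg_at_right_filter; apply: is_derive_continuous (Psid 0 _).
      by apply: inX; rewrite lexx ltW.
    + apply: cvg_at_left_filter; apply: is_derive_continuous (Psid X _).
      by apply: inX; rewrite lexx ltW.
  - move=> r; rewrite in_itv/= => /andP[r0 rX]; rewrite derive1E.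
    by have [] := Psid r (inX r _); rewrite // !ltW.
rewrite RintegralB; [|by []|exact: intu|exact: intu].
rewrite -/u -/v /Psi => /eqP; rewrite subr_eq => /eqP ->.
by rewrite addrC addrA.
Qed.

End cauchy_rectangle.

(** * Automated continuity proofs *)

Section continuity.
Context {R : realType}.
Notation mu := (@lebesgue_measure R).

Lemma cont_comp (g f : R -> R) (t : R) : {for t, continuous f} -> continuous g ->
  {for t, continuous (fun x => g (f x))}.
Proof. by move=> cf cg; exact: (@continuous_comp _ _ _ f g t cf (cg _)). Qed.

Lemma contD (f g : R -> R) (t : R) : {for t, continuous f} -> {for t, continuous g} ->
  {for t, continuous (fun x => f x + g x)}.
Proof. by move=> cf cg; exact: cvgD. Qed.

Lemma contM (f g : R -> R) (t : R) : {for t, continuous f} -> {for t, continuous g} ->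
  {for t, continuous (fun x => f x * g x)}.
Proof. by move=> cf cg; exact: cvgM. Qed.

Lemma contN (f : R -> R) (t : R) : {for t, continuous f} ->
  {for t, continuous (fun x => - f x)}.
Proof. by move=> cf; exact: cvgN. Qed.

Lemma contX (f : R -> R) n (t : R) : {for t, continuous f} ->
  {for t, continuous (fun x => f x ^+ n)}.
Proof. by move=> cf; apply: (cont_comp (fun x => x ^+ n)) => //; exact: exprn_continuous. Qed.

Lemma cont_cst (c t : R) : {for t, continuous (fun _ : R => c)}.
Proof. exact: cvg_cst. Qed.

Lemma cont_id (t : R) : {for t, continuous (fun x : R => x)}.
Proof. exact: cvg_id. Qed.

Lemma cont_ln (f : R -> R) (t : R) : {for t, continuous f} -> 0 < f t ->
  {for t, continuous (fun x => ln (f x))}.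
Proof.
move=> cf f0; apply: (@continuous_comp _ _ _ f (@ln R) t cf).
exact: is_derive_continuous _ _ _ (is_derive1_ln f0).
Qed.

Lemma contV (f : R -> R) (t : R) : {for t, continuous f} -> f t != 0 ->
  {for t, continuous (fun x => (f x)^-1)}.
Proof. by move=> cf f0; exact: continuousV. Qed.

End continuity.

(** The recursion follows the syntax of the function. Positivity under [ln], non-vanishing under an
    inverse, and subterms of no listed form are left as goals. *)
Ltac cts_fun f := lazymatch f with
  | (fun _ => ?c) => exact: cont_cst
  | (fun x => x) => exact: cont_id
  | (fun x => (@?g x + @?h x)%R) => apply: (contD g h); [cts_fun g|cts_fun h]
  | (fun x => (@?g x * @?h x)%R) => apply: (contM g h); [cts_fun g|cts_fun h]
  | (fun x => (- @?g x)%R) => apply: (contN g); cts_fun g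
  | (fun x => (@?g x ^+ ?n)%R) => apply: (contX g n); cts_fun g
  | (fun x => expR (@?g x)) =>
      apply: (cont_comp expR g); [cts_fun g|exact: continuous_expR]
  | (fun x => cos (@?g x)) =>
      apply: (cont_comp cos g); [cts_fun g|exact: continuous_cos]
  | (fun x => sin (@?g x)) =>
      apply: (cont_comp sin g); [cts_fun g|exact: continuous_sin]
  | (fun x => ln (@?g x)) => apply: (cont_ln g); [cts_fun g|]
  | (fun x => ((@?g x)^-1)%R) => apply: (contV g); [cts_fun g|]
  | _ => idtac end.

Ltac cts := lazymatch goal with
  | |- continuous ?f => let g := eval cbv beta in f in intro; cts_fun g
  | |- {for _, continuous ?f} => let g := eval cbv beta in f in cts_fun g
  end.

(** * Euler's integral after the substitution u = exp t *)

Section Gamma_exponential.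
Context {R : realType}.
Notation mu := (@lebesgue_measure R).

Lemma setopos_bigcup_expR :
  `]0, +oo[%classic = \bigcup_n `[expR (- n%:R), expR n%:R]%classic :> set R.
Proof.
apply/seteqP; split => y /=; rewrite in_itv/= ?andbT.
  move=> y0; exists (Num.truncn `|ln y|).+1 => //=; rewrite in_itv/=.
  rewrite -{2 3}(lnK (x := y)) ?posrE// !ler_expR -ler_norml ltW//.
  exact: truncnS_gt.
by move=> [n _ /=]; rewrite in_itv/= => /andP[+ _]; apply: lt_le_trans; exact: expR_gt0.
Qed.

Lemma ge0_integral_expR (f : R -> R) :
  (forall y, 0 < y -> {for y, continuous f}) -> (forall y, 0 < y -> 0 <= f y) ->
  (\int[mu]_(y in `]0%R, +oo[) (f y)%:E = \int[mu]_t (f (expR t) * expR t)%:E)%E.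
Proof.
move=> cf f0; apply: (ge0_integral_change_of_variables expR expR) => //.
- exact: continuous_expR.
- by move=> t; exact: expR_gt0.
- exact: setopos_bigcup_expR.
- by move=> t; apply: cf; exact: expR_gt0.
- by move=> y /=; rewrite in_itv/= andbT; exact: f0.
Qed.

Lemma Rintegral_expR (f : R -> R) : (forall y, 0 < y -> {for y, continuous f}) ->
  \int[mu]_(y in `]0, +oo[) f y = \int[mu]_t (f (expR t) * expR t).
Proof.
move=> cf; rewrite /Rintegral integralE [in RHS]integralE; congr (fine (_ - _)).
- transitivity (\int[mu]_(y in `]0%R, +oo[) (Num.max (f y) 0)%:E)%E.
    by apply: eq_integral => y _; rewrite funeposE EFin_max.
  rewrite ge0_integral_expR; first last.
  + by move=> y _; rewrite le_max lexx orbT.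
  + by move=> y y0; apply: continuous_max; [exact: cf|exact: cont_cst].
  apply: eq_integral => t _; rewrite funeposE -EFin_max.
  by rewrite maxr_pMl ?mul0r// expR_ge0.
- transitivity (\int[mu]_(y in `]0%R, +oo[) (Num.max (- f y) 0)%:E)%E.
    by apply: eq_integral => y _; rewrite funenegE EFin_max.
  rewrite ge0_integral_expR; first last.
  + by move=> y _; rewrite le_max lexx orbT.
  + by move=> y y0; apply: continuous_max; [apply: contN; exact: cf|exact: cont_cst].
  apply: eq_integral => t _; rewrite funenegE -EFinN -EFin_max.
  by rewrite maxr_pMl ?mul0r ?mulNr// expR_ge0.
Qed.

(** The function is at most 1/a times the sum of the exponential density and its mirror image. *)
Lemma integrable_expRN_norm (a : R) : 0 < a ->
  mu.-integrable [set: R] (fun t => (expR (- a * `|t|))%:E).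
Proof.
move=> a0.
have me := @measurable_exponential_pdf R a.
have mN : measurable_fun [set: R] (fun t => exponential_pdf a (- t)).
  exact: measurableT_comp.
have i1 := integrable_exponential_pdf a0.
have i2 : mu.-integrable [set: R] (EFin \o (fun t => exponential_pdf a (- t))).
  apply/integrableP; split; first exact/measurable_EFinP.
  rewrite /= (ge0_integral_opp (fun t => `|(exponential_pdf a t)%:E|%E))//.
    by have /integrableP[] := i1.
  by apply: measurableT_comp => //; exact/measurable_EFinP.
have key (t : R) : expR (- a * `|t|) <=
    a^-1 * (exponential_pdf a t + exponential_pdf a (- t)).
  rewrite -ler_pdivrMl ?invr_gt0// invrK.
  have [t0|t0] := leP 0 t.
    by rewrite (ger0_norm t0) exponential_pdfE// lerDl exponential_pdf_ge0// ltW.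
  rewrite (ltr0_norm t0) addrC exponential_pdfE; last by rewrite oppr_ge0 ltW.
  by rewrite lerDl exponential_pdf_ge0// ltW.
apply: (@le_integrable _ _ _ mu _ measurableT _
    (fun t => (a^-1 * (exponential_pdf a t + exponential_pdf a (- t)))%:E)).
- apply/measurable_EFinP; apply: measurableT_comp => //.
  exact: measurable_funM.
- move=> t _; rewrite lee_fin ger0_norm ?expR_ge0//.
  exact: le_trans (key t) (ler_norm _).
- under eq_fun do rewrite EFinM.
  apply: integrableZl => //.
  under eq_fun do rewrite EFinD.
  exact: integrableD.
Qed.

Lemma integrable_expR_expR (a c : R) : 0 < a -> 0 < c ->
  mu.-integrable [set: R] (fun t => (expR (a * t - c * expR t))%:E).
Proof.
move=> a0 c0.
(* For t < 0 the factor exp (a t) alone suffices. For t >= 0, exp t >= t^2 / 4, and 4 a^2 / c is the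
   cost of completing the square in 2 a t <= c t^2 / 4 + 4 a^2 / c. *)
have key (t : R) : expR (a * t - c * expR t) <=
    expR (4 * a ^+ 2 / c) * expR (- a * `|t|).
  rewrite -expRD ler_expR.
  have c1 : 0 <= 4 * a ^+ 2 / c by rewrite divr_ge0 ?mulr_ge0 ?sqr_ge0// ltW.
  have [t0|t0] := leP 0 t.
    rewrite (ger0_norm t0).
    have e1 : (1 + t / 2) ^+ 2 <= expR t.
      rewrite (_ : expR t = expR (t / 2) ^+ 2); last by rewrite -expRM_natl; congr expR; field.
      by rewrite lerXn2r ?nnegrE ?expR_ge0 ?addr_ge0 ?divr_ge0// expR_ge1Dx.
    have e2 : c * (t ^+ 2 / 4) <= c * expR t by rewrite ler_pM2l//; nra.
    have : 0 <= (c * t / 2 - 2 * a) ^+ 2 / c by rewrite divr_ge0 ?sqr_ge0// ltW.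
    have -> : (c * t / 2 - 2 * a) ^+ 2 / c = c * (t ^+ 2 / 4) - 2 * a * t + 4 * a ^+ 2 / c.
      by field; rewrite gt_eqF.
    lra.
  by rewrite (ltr0_norm t0) mulrNN; have := expR_gt0 t; nra.
apply: (@le_integrable _ _ _ mu _ measurableT _
    (fun t => ((expR (4 * a ^+ 2 / c))%:E * (expR (- a * `|t|))%:E)%E)).
- apply/measurable_EFinP; apply: continuous_measurable_fun; cts.
- move=> t _; rewrite -EFinM lee_fin ger0_norm ?expR_ge0//.
  exact: le_trans (key t) (ler_norm _).
- by apply: integrableZl => //; exact: integrable_expRN_norm.
Qed.

Lemma GammaE (a : R) : Gamma a = \int[mu]_t expR (a * t - expR t).
Proof.
rewrite /Gamma Rintegral_expR.
  apply: eq_Rintegral => t _; rewrite -expRM -!expRD; congr expR; ring.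
move=> y y0; apply: contM; last by cts.
exact: is_derive_continuous _ _ _ (is_derive1_powR (a - 1) y0).
Qed.

(** Scaling the variable of Euler's integral by [expR g] is a translation by [g] here. *)
Lemma integral_expR_expR (a g : R) : 0 < a ->
  (\int[mu]_t (expR (a * t - expR g * expR t))%:E = (expR (- a * g) * Gamma a)%:E)%E.
Proof.
move=> a0.
pose f t := expR (a * (t - g) - expR t).
have mf : measurable_fun [set: R] (fun t => (f t)%:E).
  by apply/measurable_EFinP; apply: continuous_measurable_fun; rewrite /f; cts.
transitivity (\int[mu]_t (f (t + g)%R)%:E)%E.
  by apply: eq_integral => t _; rewrite /f addrK (expRD t) (mulrC (expR t)).
rewrite (ge0_integral_shift g (fun t => (f t)%:E))// => [|t]; last first.
  by rewrite lee_fin expR_ge0.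
transitivity (\int[mu]_t ((expR (- a * g))%:E * (expR (a * t - 1 * expR t))%:E))%E.
  by apply: eq_integral => t _; rewrite -EFinM -expRD; congr (expR _)%:E; ring.
have i1 := integrable_expR_expR a 1 a0 ltr01.
rewrite integralZl// EFinM GammaE /Rintegral fineK.
  by congr (_ * _)%E; apply: eq_integral => t _; rewrite mul1r.
under eq_integral do rewrite -[X in _ - X]mul1r.
exact: integrable_fin_num.
Qed.

(** On [[0, 1]] the exponential form of the integrand is at least the constant [expR (- expR 1)]. *)
Lemma Gamma_gt0 (a : R) : 0 < a -> 0 < Gamma a.
Proof.
move=> a0; rewrite -lte_fin.
have := integral_expR_expR a 0 a0; rewrite mulr0 expR0 mul1r => <-.
apply: (@lt_le_trans _ _ (\int[mu]_(t in `[0%R, 1%R]) (expR (- expR 1))%:E)%E).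
  rewrite integral_cst//= lebesgue_measure_itv/= lte_fin ltr01 -EFinB subr0 mule1.
  by rewrite lte_fin expR_gt0.
apply: (@le_trans _ _ (\int[mu]_(t in `[0%R, 1%R]) (expR (a * t - 1 * expR t))%:E)%E).
  apply: ge0_le_integral => //.
  - by apply/measurable_EFinP; apply: measurable_funTS; apply: continuous_measurable_fun; cts.
  - move=> t; rewrite /= in_itv/= => /andP[t0 t1]; rewrite lee_fin ler_expR mul1r.
    have : expR t <= expR 1 by rewrite ler_expR.
    have : 0 <= a * t by rewrite mulr_ge0// ltW.
    lra.
apply: ge0_subset_integral => //=.
by apply/measurable_EFinP; apply: continuous_measurable_fun; cts.
Qed.

End Gamma_exponential.

(** * Gaussian integrals and a hyperbolic substitution *)

Section gaussian_integrals.
Context {R : realType}.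
Notation mu := (@lebesgue_measure R).

(** Monotone convergence for the positive and negative parts; integrability keeps the difference of
    the two limits meaningful. *)
Lemma cvg_Rintegral_bigcup (F : (set R)^nat) (f : R -> R) :
  nondecreasing_seq F -> (forall n, measurable (F n)) ->
  mu.-integrable (\bigcup_n F n) (EFin \o f) ->
  \int[mu]_(x in F n) f x @[n --> \oo] --> \int[mu]_(x in \bigcup_n F n) f x.
Proof.
move=> ndF mF fi.
have mU : measurable (\bigcup_n F n) by exact: bigcup_measurable.
have mf : measurable_fun (\bigcup_n F n) (EFin \o f) by exact: measurable_int fi.
have sub n : F n `<=` \bigcup_n F n by move=> x Fx; exists n.
have mfn n : measurable_fun (F n) (EFin \o f) by exact: measurable_funS (sub n) mf.
apply: fine_cvg; rewrite fineK; last exact: integrable_fin_num.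
under eq_fun do rewrite integralE.
rewrite integralE.
apply: cvgeB.
- rewrite fin_num_adde_defl//.
  by rewrite fin_numN; apply: integrable_neg_fin_num.
- apply: ge0_nondecreasing_set_cvg_integral => //.
  by move=> n; apply: measurable_funepos; exact: mfn.
- apply: ge0_nondecreasing_set_cvg_integral => //.
  by move=> n; apply: measurable_funeneg; exact: mfn.
Qed.

Lemma integralT_gauss_scale (c : R) : 0 < c ->
  (\int[mu]_y (expR (- (c ^+ 2 * y ^+ 2)))%:E = (Num.sqrt pi / c)%:E)%E.
Proof.
move=> c0.
have h : (\int[mu]_y (gauss_fun (c * y) * c)%:E = (Num.sqrt pi)%:E)%E.
  rewrite -integralT_gauss; apply/esym.
  apply: (ge0_integral_change_of_variables (fun y => c * y) (fun=> c)) => //.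
  - by move=> t; apply: is_derive_eq; rewrite /GRing.scale/= mulr1.
  - by move=> t; exact: cvg_cst.
  - apply/seteqP; split => // y _.
    exists (Num.truncn (`|y| / c)).+1 => //=; rewrite in_itv/=.
    rewrite mulrN -ler_norml -ler_pdivrMl// mulrC ltW//; exact: truncnS_gt.
  - by move=> t; exact: continuous_gauss_fun.
  - by move=> y _; exact: gauss_fun_ge0.
transitivity (\int[mu]_y ((c^-1)%:E * (gauss_fun (c * y) * c)%:E))%E.
  apply: eq_integral => y _; rewrite -EFinM /gauss_fun exprMn; congr (_%:E).
  by field; rewrite gt_eqF.
rewrite ge0_integralZl_EFin//.
- by rewrite h -EFinM mulrC.
- by move=> y _; rewrite lee_fin mulr_ge0 ?gauss_fun_ge0// ltW.
- apply/measurable_EFinP; apply: continuous_measurable_fun.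
  by rewrite /gauss_fun; cts.
- by rewrite invr_ge0 ltW.
Qed.

(* Symmetrising replaces [expR (s / 4)] by a hyperbolic cosine, and
   [y = 2 q sinh (s / 4)] then satisfies
   [y ^ 2 = q ^ 2 (expR (s / 2) + expR (- (s / 2)) - 2)]. *)
Lemma integral_expR_cosh (q : R) : 0 < q ->
  (\int[mu]_s (expR (s / 4) * expR (- (q ^+ 2 * (expR (s / 2) + expR (- (s / 2))))))%:E
   = (2 * Num.sqrt pi * expR (- (2 * q ^+ 2)) / q)%:E)%E.
Proof.
move=> q0.
pose g (s : R) := expR (- (q ^+ 2 * (expR (s / 2) + expR (- (s / 2))))).
have cg : continuous g by rewrite /g; cts.
pose phi (s : R) := q * (expR (s / 4) - expR (- (s / 4))).
pose dphi (s : R) := q / 4 * (expR (s / 4) + expR (- (s / 4))).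
have phig s : gauss_fun (phi s) * dphi s =
    q / 4 * expR (2 * q ^+ 2) * (expR (s / 4) * g s + expR (- s / 4) * g s).
  have e1 : expR (s / 2) = expR (s / 4) ^+ 2.
    by rewrite -expRM_natl; congr expR; field.
  have e2 : expR (- (s / 2)) = expR (- (s / 4)) ^+ 2.
    by rewrite -expRM_natl; congr expR; field.
  have e3 : expR (s / 4) * expR (- (s / 4)) = 1 by rewrite -expRD subrr expR0.
  rewrite /gauss_fun /phi /dphi /g e1 e2 mulNr -mulrDl.
  have -> : - (q * (expR (s / 4) - expR (- (s / 4)))) ^+ 2 =
      2 * q ^+ 2 + - (q ^+ 2 * (expR (s / 4) ^+ 2 + expR (- (s / 4)) ^+ 2)).
    transitivity (- q ^+ 2 * (expR (s / 4) ^+ 2 + expR (- (s / 4)) ^+ 2)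
      + 2 * q ^+ 2 * (expR (s / 4) * expR (- (s / 4)))); first by ring.
    by rewrite e3; ring.
  by rewrite expRD; ring.
have H : (\int[mu]_s (gauss_fun (phi s) * dphi s)%:E = (Num.sqrt pi)%:E)%E.
  rewrite -integralT_gauss; apply/esym.
  (* This linear lower bound, with the oddness of [phi], makes the image intervals exhaust the
     line. *)
  have phi_ge n : n%:R * (q / 4) <= phi n%:R.
    rewrite /phi mulrC -mulrA ler_pM2l// mulrC.
    have := expR_ge1Dx (n%:R / 4 : R).
    have : expR (- (n%:R / 4)) <= (1 : R).
      by rewrite -[leRHS]expR0 ler_expR oppr_le0 divr_ge0.
    lra.
  apply: (ge0_integral_change_of_variables phi dphi) => //.
  - move=> t.
    have d1 : is_derive t (1 : R) (fun s : R => s / 4) (1 / 4).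
      by apply: is_derive_eq; rewrite /GRing.scale/= !mulr0 add0r mulrC.
    have d2 := @is_derive1_comp _ expR _ t _ _ (is_derive_expR _) d1.
    have d3 := @is_derive1_comp _ expR _ t _ _ (is_derive_expR _) (is_deriveN d1).
    have d4 := is_deriveZ q (is_deriveB d2 d3).
    by apply: (is_derive_eq d4); rewrite /dphi /GRing.scale/=; field.
  - by rewrite /dphi; cts.
  - by move=> t; rewrite /dphi mulr_gt0 ?divr_gt0 ?addr_gt0 ?expR_gt0.
  - apply/seteqP; split => // y _.
    exists (Num.truncn (`|y| / (q / 4))).+1 => //=; rewrite in_itv/=.
    have -> : phi (- (Num.truncn (`|y| / (q / 4))).+1%:R) =
        - phi (Num.truncn (`|y| / (q / 4))).+1%:R.
      by rewrite /phi mulNr opprK; ring.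
    rewrite -ler_norml (le_trans _ (phi_ge _))//.
    rewrite -ler_pdivrMr ?divr_gt0// ltW//; exact: truncnS_gt.
  - by move=> t; exact: continuous_gauss_fun.
  - by move=> y _; exact: gauss_fun_ge0.
pose J := (\int[mu]_s (expR (s / 4) * g s)%:E)%E.
have Jopp : (\int[mu]_s (expR (- s / 4) * g s)%:E = J)%E.
  rewrite /J -(ge0_integral_opp (fun s => (expR (s / 4) * g s)%:E)).
  - apply: eq_integral => s _; congr (_ * _)%:E.
    by rewrite /g !mulNr opprK [in RHS]addrC.
  - by apply/measurable_EFinP; apply: continuous_measurable_fun; rewrite /g; cts.
  - by move=> s; rewrite lee_fin mulr_ge0 ?expR_ge0.
have k0 : 0 < q / 4 * expR (2 * q ^+ 2) by rewrite mulr_gt0 ?divr_gt0 ?expR_gt0.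
have HJ : ((q / 4 * expR (2 * q ^+ 2))%:E * (J + J) = (Num.sqrt pi)%:E)%E.
  have m1 : measurable_fun [set: R] (fun s => (expR (s / 4) * g s)%:E).
    by apply/measurable_EFinP; apply: continuous_measurable_fun; rewrite /g; cts.
  have m2 : measurable_fun [set: R] (fun s => (expR (- s / 4) * g s)%:E).
    by apply/measurable_EFinP; apply: continuous_measurable_fun; rewrite /g; cts.
  have n1 s : setT s -> (0 <= (expR (s / 4) * g s)%:E)%E.
    by rewrite lee_fin mulr_ge0 ?expR_ge0.
  have n2 s : setT s -> (0 <= (expR (- s / 4) * g s)%:E)%E.
    by rewrite lee_fin mulr_ge0 ?expR_ge0.
  rewrite -H -{2}Jopp /J -ge0_integralD; [|by []|exact: n1|exact: m1|exact: n2|exact: m2].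
  rewrite -ge0_integralZl_EFin; [|by []| |exact: emeasurable_funD|exact: ltW]; last first.
    by move=> s _; rewrite -EFinD lee_fin addr_ge0// mulr_ge0 ?expR_ge0.
  by apply: eq_integral => s _; rewrite phig.
have J0 : (0 <= J)%E.
  by apply: integral_ge0 => s _; rewrite lee_fin mulr_ge0 ?expR_ge0.
(* [HJ] equates a positive multiple of [J + J] with a real number, which excludes the value +oo;
   [J0] excludes -oo. *)
rewrite -/g -/J; move: HJ J0; case: J {Jopp} => [r| |]//; last first.
  by rewrite addye// gt0_muley.
rewrite -EFinD -EFinM => -[HJ] _; congr (_%:E).
rewrite expRN; apply: (mulfI (lt0r_neq0 k0)); apply: (@mulfI _ 2) => //.
transitivity (q / 4 * expR (2 * q ^+ 2) * (r + r)); first by ring.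
by rewrite HJ; field; rewrite !gt_eqF ?expR_gt0.
Qed.

End gaussian_integrals.

(** * The Beta integral *)

Section beta_integral.
Context {R : realType}.
Notation mu := (@lebesgue_measure R).

(* The value B((a + 1) / 2, a / 2), with the duplication formula for
   Gamma(a / 2) Gamma((a + 1) / 2) already applied. *)
Lemma integral_beta (a : R) : 0 < a ->
  (\int[mu]_(s in `]0%R, +oo[)
     (expR ((a - 1) / 2 * ln s - (a + 1 / 2) * ln (1 + s)))%:E
   = (expR (- a * ln 2) * (2 * Num.sqrt pi) * Gamma a / Gamma (a + 1 / 2))%:E)%E.
Proof.
move=> a0; set b := a + 1 / 2.
have b0 : 0 < b by rewrite /b; lra.
pose c (s : R) := expR (s / 2) + expR (- (s / 2)).
have c0 s : 0 < c s by rewrite addr_gt0 ?expR_gt0.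
have e1 (s : R) : 1 + expR s = expR (s / 2) * c s.
  rewrite /c mulrDr -!expRD subrr expR0 addrC; congr (expR _ + _); lra.
rewrite ge0_integral_expR; last 2 first.
- by move=> y y0; cts; rewrite ?addr_gt0.
- by move=> y y0; exact: expR_ge0.
(* Tonelli is applied to this kernel. Integrated in t it is Gamma(b) times the Beta integrand after
   s -> exp s; integrated in s it is [integral_expR_cosh] with q = exp (t / 2), leaving 2 sqrt(pi)
   exp (a t - 2 exp t). The rate 2 is the source of the factor 2^(- a). *)
pose h (z : R * R) := expR (z.1 / 4) * expR (b * z.2 - c z.1 * expR z.2).
have mh : measurable_fun [set: R * R] (fun z => (h z)%:E).
  apply/measurable_EFinP; rewrite /h /c.
  apply: measurable_funM; first by apply: measurableT_comp => //; exact: measurable_funM.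
  apply: measurableT_comp => //; apply: measurable_funB.
    exact: measurable_funM.
  apply: measurable_funM; last exact: measurableT_comp.
  apply: measurable_funD; apply: measurableT_comp => //.
    exact: measurable_funM.
  by apply: measurableT_comp => //; exact: measurable_funM.
have h0 z : (0 <= (h z)%:E)%E by rewrite lee_fin mulr_ge0 ?expR_ge0.
have T := @fubini_tonelli _ _ _ _ R mu mu _ mh h0.
have lhs (s : R) : (\int[mu]_t (h (s, t))%:E =
    (Gamma b)%:E * (expR ((a - 1) / 2 * ln (expR s) - b * ln (1 + expR s)) * expR s)%:E)%E.
  rewrite /h/=; move: (c s) (c0 s) (e1 s) => k k0 ek.
  under eq_integral do rewrite EFinM.
  rewrite ge0_integralZl_EFin; [|by []| | |exact: expR_ge0]; last 2 first.
  - by move=> t _; rewrite lee_fin expR_ge0.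
  - by apply/measurable_EFinP; apply: continuous_measurable_fun; cts.
  have e2 : expR (ln k) = k by apply: lnK; rewrite posrE.
  rewrite -[in LHS]e2 (integral_expR_expR _ _ b0) -!EFinM; congr (_%:E).
  rewrite [RHS]mulrC mulrA -!expRD; congr (expR _ * _).
  have e3 : ln (1 + expR s) = s / 2 + ln k.
    rewrite ek lnM; [|by rewrite posrE expR_gt0|by rewrite posrE].
    by rewrite expRK.
  rewrite e3 expRK /b; by move: (ln k) => l; field.
have rhs (t : R) : (\int[mu]_s (h (s, t))%:E =
   (2 * Num.sqrt pi)%:E * (expR (a * t - expR (ln 2) * expR t))%:E)%E.
  have et : expR t = expR (t / 2) ^+ 2 by rewrite -expRM_natl; congr expR; field.
  have E (z : R) : h (z, t) = expR (b * t) * (expR (z / 4) *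
      expR (- (expR (t / 2) ^+ 2 * (expR (z / 2) + expR (- (z / 2)))))).
    by rewrite /h [(z, t).1]/= [(z, t).2]/= et /c expRD (mulrC (expR (z / 2) + _)); ring.
  under eq_integral do rewrite E EFinM.
  rewrite ge0_integralZl_EFin; [|by []| | |exact: expR_ge0]; last 2 first.
  - by move=> z _; rewrite lee_fin mulr_ge0 ?expR_ge0.
  - by apply/measurable_EFinP; apply: continuous_measurable_fun; cts.
  rewrite (integral_expR_cosh _ (expR_gt0 _)) -!EFinM; congr (_%:E).
  have e2 : expR (ln 2) = 2 :> R by apply: lnK; rewrite posrE.
  rewrite e2 -expRN -et.
  transitivity (2 * Num.sqrt pi * (expR (b * t) * expR (- (2 * expR t)) * expR (- (t / 2)))).
    by ring.
  by rewrite -!expRD; congr (_ * expR _); rewrite /b; field.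
pose F (s : R) := expR ((a - 1) / 2 * ln (expR s) - b * ln (1 + expR s)) * expR s.
have L : (\int[mu]_s \int[mu]_t (h (s, t))%:E = \int[mu]_s ((Gamma b)%:E * (F s)%:E))%E.
  by apply: eq_integral => s _; exact: lhs.
have M : (\int[mu]_t \int[mu]_s (h (s, t))%:E =
    \int[mu]_t ((2 * Num.sqrt pi)%:E * (expR (a * t - expR (ln 2) * expR t))%:E))%E.
  by apply: eq_integral => t _; exact: rhs.
move: (etrans (esym L) (etrans T M)) => {L M T}.
rewrite ge0_integralZl_EFin; [|by []| | |exact/ltW/Gamma_gt0]; last 2 first.
- by move=> s _; rewrite lee_fin /F mulr_ge0 ?expR_ge0.
- apply/measurable_EFinP; apply: continuous_measurable_fun; rewrite /F.
  by cts; rewrite ?addr_gt0 ?expR_gt0.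
rewrite ge0_integralZl_EFin; [|by []| | |by rewrite mulr_ge0// sqrtr_ge0]; last 2 first.
- by move=> s _; rewrite lee_fin expR_ge0.
- by apply/measurable_EFinP; apply: continuous_measurable_fun; cts.
rewrite (integral_expR_expR _ _ a0).
set I := (\int[mu]_t _)%E => HI.
have Gb0 := Gamma_gt0 b b0.
(* Cancelling the positive factor this way is valid in the extended reals, before [I] is known to be
   finite. *)
have -> : I = ((Gamma b)^-1%:E * ((Gamma b)%:E * I))%E.
  by rewrite muleA -EFinM mulVf ?gt_eqF// mul1e.
by rewrite HI -!EFinM; congr (_%:E); ring.
Qed.

End beta_integral.

(** * Automated derivatives *)

Section derivatives.
Context {R : realType}.
Implicit Types (f g : R -> R) (x df dg : R).

(* [is_derive] is a class: [apply] would hand premises of that form to instance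
   resolution instead of leaving them as goals. *)
Definition hasder f x d := is_derive x (1 : R) f d.

Lemma der_eq f x d d' : hasder f x d -> d = d' -> is_derive x (1 : R) f d'.
Proof. by move=> + <-. Qed.

Lemma der_cst (c x : R) : hasder (fun _ : R => c) x 0.
Proof. exact: is_derive_cst. Qed.

Lemma der_id x : hasder (fun z : R => z) x 1.
Proof. exact: is_derive_id. Qed.

Lemma der_D f g x df dg : hasder f x df -> hasder g x dg ->
  hasder (fun z => f z + g z) x (df + dg).
Proof. by move=> hf hg; exact: is_deriveD. Qed.

Lemma der_N f x df : hasder f x df ->
  hasder (fun z => - f z) x (- df).
Proof. by move=> hf; exact: is_deriveN. Qed.

Lemma der_M f g x df dg : hasder f x df -> hasder g x dg ->
  hasder (fun z => f z * g z) x (df * g x + f x * dg).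
Proof.
move=> hf hg; apply: (is_derive_eq (is_deriveM hf hg)).
by rewrite /GRing.scale/= addrC (mulrC df).
Qed.

Lemma der_X2 f x df : hasder f x df ->
  hasder (fun z => f z ^+ 2) x (2 * f x * df).
Proof.
move=> hf; have := der_M f f x df df hf hf.
rewrite (_ : (fun z => f z * f z) = (fun z => f z ^+ 2)); last first.
  by apply/funext => z; rewrite expr2.
by move=> h; apply: (is_derive_eq h); ring.
Qed.

Lemma der_V f x df : hasder f x df -> f x != 0 ->
  hasder (fun z => (f z)^-1) x (- (f x ^- 2) * df).
Proof.
by move=> hf fx0; exact: (is_derive_eq (is_deriveV fx0 hf)).
Qed.

Lemma der_ln f x df : hasder f x df -> 0 < f x ->
  hasder (fun z => ln (f z)) x ((f x)^-1 * df).
Proof.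
move=> hf fx0.
exact: (@is_derive1_comp _ (@ln R) f x _ _ (is_derive1_ln fx0) hf).
Qed.

Lemma der_atan f x df : hasder f x df ->
  hasder (fun z => atan (f z)) x ((1 + f x ^+ 2)^-1 * df).
Proof.
by move=> hf; exact: (@is_derive1_comp _ (@atan R) f x _ _ (is_derive1_atan _) hf).
Qed.

End derivatives.

Ltac der_fun f := lazymatch f with
  | (fun _ => ?c) => apply: der_cst
  | (fun x => x) => apply: der_id
  | (fun x => (@?g x + @?h x)%R) => apply: (der_D g h); [der_fun g|der_fun h]
  | (fun x => (@?g x * @?h x)%R) => apply: (der_M g h); [der_fun g|der_fun h]
  | (fun x => (- @?g x)%R) => apply: (der_N g); der_fun g
  | (fun x => (@?g x ^+ 2)%R) => apply: (der_X2 g); der_fun g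
  | (fun x => ((@?g x)^-1)%R) => apply: (der_V g); [der_fun g|]
  | (fun x => ln (@?g x)) => apply: (der_ln g); [der_fun g|]
  | (fun x => atan (@?g x)) => apply: (der_atan g); der_fun g
  | _ => idtac end.

(** The derivative is built from the syntax as an existential variable; its equality with the stated
    one is the last goal, after any side conditions of [ln] and of inverses. *)
Ltac der := lazymatch goal with
  | |- is_derive _ _ ?f _ => let g := eval cbv beta in f in
      apply: der_eq; [der_fun g|cbv beta] end.

(** * The cosine transform of a Gaussian *)

Section gaussian_cosine.
Context {R : realType}.
Notation mu := (@lebesgue_measure R).

Lemma integral_gauss_half (v : R) : 0 < v ->
  (\int[mu]_(p in `[0%R, +oo[) (expR (- (v ^+ 2 * p ^+ 2)))%:E = (Num.sqrt pi / v / 2)%:E)%E.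
Proof.
move=> v0; have := integralT_gauss_scale v v0.
rewrite (ge0_symfun_integralT (f := fun p => expR (- (v ^+ 2 * p ^+ 2)))); first last.
- by move=> p /=; rewrite sqrrN.
- by cts.
- by move=> p; exact: expR_ge0.
rewrite (_ : [set p | _] = `[0%R, +oo[%classic); last first.
  by apply/seteqP; split => p /=; rewrite in_itv/= andbT.
set I := (\int[mu]_(p in _) _)%E => h.
have -> : I = ((2^-1)%:E * (2%:E * I))%E by rewrite muleA -EFinM mulVf// mul1e.
by rewrite h -EFinM mulrC.
Qed.

Lemma integrable_gauss_half (v : R) : 0 < v ->
  mu.-integrable `[0, +oo[ (EFin \o (fun p : R => expR (- (v ^+ 2 * p ^+ 2)))).
Proof.
move=> v0; apply/integrableP; split.
  by apply/measurable_EFinP; apply: measurable_funTS; apply: continuous_measurable_fun; cts.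
rewrite (_ : (\int[mu]_(p in _) _)%E = (Num.sqrt pi / v / 2)%:E) ?ltry//.
rewrite -integral_gauss_half//; apply: eq_integral => p _.
by rewrite gee0_abs// lee_fin expR_ge0.
Qed.

Lemma integrable_gauss_cos (v x : R) : 0 < v ->
  mu.-integrable `[0, +oo[ (EFin \o (fun p : R => expR (- (v ^+ 2 * p ^+ 2)) * cos (x * p))).
Proof.
move=> v0; have := integrable_gauss_half v v0.
apply: le_integrable => //.
  by apply/measurable_EFinP; apply: measurable_funTS; apply: continuous_measurable_fun; cts.
move=> p _; rewrite lee_fin normrM ler_piMr//.
by rewrite ler_norml cos_geN1 cos_le1.
Qed.

Lemma setcy_bigcup : `[0, +oo[%classic = \bigcup_n `[0, n.+1%:R]%classic :> set R.
Proof.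
apply/seteqP; split => y /=; rewrite in_itv/= ?andbT.
  move=> y0; exists (Num.truncn y) => //=; rewrite in_itv/= y0 ltW//.
  exact: truncnS_gt.
by move=> [n _ /=]; rewrite in_itv/= => /andP[].
Qed.

Lemma setcy_nondecreasing : nondecreasing_seq (fun n => `[0, n.+1%:R]%classic : set R).
Proof.
apply/nondecreasing_seqP => n; rewrite subsetEset.
by apply: subset_itv; rewrite bnd_simp// ler_nat.
Qed.

(* On the line Im z = Y = x / (2 v ^ 2), the function exp (- v ^ 2 z ^ 2) is a
   multiple of exp (- v ^ 2 r ^ 2 - i x r). *)
Lemma Rintegral_gauss_cos (v x : R) : 0 < v -> 0 < x ->
  \int[mu]_(p in `[0, +oo[) (expR (- (v ^+ 2 * p ^+ 2)) * cos (x * p)) =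
  Num.sqrt pi / v / 2 * expR (- (x ^+ 2 / (4 * v ^+ 2))).
Proof.
move=> v0 x0.
have i1 := integrable_gauss_half v v0; have i2 := integrable_gauss_cos v x v0.
have := integral_gauss_half v v0.
have : 0 < v ^+ 2 by rewrite exprn_gt0.
move: (v ^+ 2) i1 i2 => u i1 i2 u0 half.
pose Y := x / (2 * u).
have Y0 : 0 < Y by rewrite divr_gt0// mulr_gt0.
pose g (p : R) := expR (- (u * p ^+ 2)).
pose gc (p : R) := expR (- (u * p ^+ 2)) * cos (x * p).
(* The vertical side Re z = X of the rectangle, whose height [Y] stays fixed while X tends to
   infinity. *)
pose rem (X : R) := \int[mu]_(y in `[0, Y])
  (expR (- (u * (X ^+ 2 - y ^+ 2))) * sin (- (2 * u * X * y))).
have rect X : 0 < X -> \int[mu]_(r in `[0, X]) g r =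
    expR (u * Y ^+ 2) * (\int[mu]_(r in `[0, X]) gc r) + rem X.
  move=> X0.
  have n1 : -1 < 0 :> R by rewrite ltrN10.
  have n2 : X < X + 1 by rewrite ltrDl.
  pose bnd := expR (u * Y ^+ 2) * (2 * u * Y + 2 * u * (X + 1)).
  have d1 r y : -1 < r < X + 1 -> is_derive r (1 : R) 
      (fun r => - (u * (r ^+ 2 - y ^+ 2))) (- (2 * u * r)).
    by move=> _; der; ring.
  have d2 r y : -1 < r < X + 1 -> is_derive y (1 : R) (fun y => - (2 * u * r * y)) (- (2 * u * r)).
    by move=> _; der; ring.
  have d3 r y : -1 < r < X + 1 -> is_derive r (1 : R) (fun r => - (2 * u * r * y)) (- (2 * u * y)).
    by move=> _; der; ring.
  have d4 r y : -1 < r < X + 1 -> is_derive y (1 : R) 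
      (fun y => - (u * (r ^+ 2 - y ^+ 2))) (- - (2 * u * y)).
    by move=> _; der; ring.
  have c1 (r : R) : -1 < r < X + 1 -> continuous (fun _ : R => - (2 * u * r)).
    by move=> _; cts.
  have c2 (r : R) : -1 < r < X + 1 -> continuous (fun y : R => - (2 * u * y)).
    by move=> _; cts.
  have bd (r y : R) : -1 < r < X + 1 -> 0 <= y <= Y ->
      expR (- (u * (r ^+ 2 - y ^+ 2))) * (`|- (2 * u * y)| + `|- (2 * u * r)|) <= bnd.
    move=> /andP[r1 r2] /andP[y1 y2]; apply: ler_pM; rewrite ?expR_ge0 ?addr_ge0//.
      rewrite ler_expR; have : y ^+ 2 <= Y ^+ 2 by rewrite lerXn2r ?nnegrE// ltW.
      have := sqr_ge0 r; nra.
    rewrite !normrN !normrM !normr_nat (gtr0_norm u0) (ger0_norm y1).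
    have : `|r| <= X + 1 by rewrite ler_norml; apply/andP; split; lra.
    nra.
  have H := cauchy_rectangle (fun r y => - (u * (r ^+ 2 - y ^+ 2)))
    (fun r y => - (2 * u * r * y)) (fun r y => - (2 * u * r)) (fun r y => - (2 * u * y))
    (-1) (X + 1) X Y bnd n1 X0 n2 Y0 d1 d2 d3 d4 c1 c2 bd.
  cbv beta in H.
  rewrite /g.
  transitivity (\int[mu]_(r in `[0, X]) (expR (- (u * (r ^+ 2 - 0 ^+ 2))) *
      cos (- (2 * u * r * 0)))).
    by apply: eq_Rintegral => r _; rewrite mulr0 oppr0 cos0 mulr1 expr0n/= subr0.
  rewrite {}H.
  (* The function is real on the imaginary axis, so the left side contributes nothing. *)
  rewrite [X in _ - X](_ : _ = 0) ?subr0; last first.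
    rewrite (_ : (fun y : R => _) = cst 0) ?Rintegral_cst//= ?mul0r//.
    by apply/funext => y; rewrite mulr0 mul0r oppr0 sin0 mulr0.
  congr (_ + _); rewrite -RintegralZl//.
    apply: eq_Rintegral => r _; rewrite /gc mulrA -expRD; congr (expR _ * _).
      by ring.
    by rewrite cosN /Y; congr cos; field; rewrite gt_eqF.
  apply: continuous_compact_integrable; first exact: segment_compact.
  by apply: continuous_subspaceT; rewrite /gc; cts.
(* For X = n + 1 and 0 <= y <= Y, n <= X^2 bounds the modulus by exp (u Y^2) exp (- u)^n: a
   geometric rate. *)
have cvg_rem : rem n.+1%:R @[n --> \oo] --> (0 : R).
  apply: (@squeeze_cvgr _ _ _ _ (fun n => - (Y * expR (u * Y ^+ 2) * (expR (- u)) ^+ n))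
      (fun n => Y * expR (u * Y ^+ 2) * (expR (- u)) ^+ n)).
  - near=> n; rewrite -ler_norml /rem.
    set k := (X in _ <= X).
    have ci (X : R) : mu.-integrable `[0, Y]
        (EFin \o (fun y : R => expR (- (u * (X ^+ 2 - y ^+ 2))) * sin (- (2 * u * X * y)))).
      apply: continuous_compact_integrable; first exact: segment_compact.
      by apply: continuous_subspaceT; cts.
    apply: (le_trans (le_normr_Rintegral _ (ci _))); first exact: measurable_itv.
    apply: (@le_trans _ _ (\int[mu]_(y in `[0, Y])
        (cst (expR (u * Y ^+ 2) * (expR (- u)) ^+ n) y))).
      apply: le_Rintegral => //; first exact: integrable_norm.
        apply: continuous_compact_integrable; first exact: segment_compact.
        by apply: continuous_subspaceT => ?; exact: cvg_cst.
      move=> y; rewrite /= in_itv/= => /andP[y1 y2].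
      rewrite normrM (ger0_norm (expR_ge0 _)) -[leRHS]mulr1.
      apply: ler_pM; [exact: expR_ge0|exact: normr_ge0| |by rewrite ler_norml sin_geN1 sin_le1].
      rewrite -expRM_natl -expRD ler_expR.
      have : y ^+ 2 <= Y ^+ 2 by rewrite lerXn2r ?nnegrE// ltW.
      have : n%:R <= n.+1%:R ^+ 2 :> R.
        by rewrite -natrX ler_nat (leq_trans (leqnSn n))// -mulnn leq_pmulr.
      nra.
    rewrite Rintegral_cst//= lebesgue_measure_itv/= lte_fin Y0 /= oppr0 addr0 /k.
    by rewrite mulrC mulrA.
  - rewrite -oppr0; apply: cvgN; rewrite -(mulr0 (Y * expR (u * Y ^+ 2))).
    apply: cvgM; first exact: cvg_cst.
    by apply: cvg_expr; rewrite ger0_norm ?expR_ge0// -expR0 ltr_expR oppr_lt0.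
  - rewrite -(mulr0 (Y * expR (u * Y ^+ 2))).
    apply: cvgM; first exact: cvg_cst.
    by apply: cvg_expr; rewrite ger0_norm ?expR_ge0// -expR0 ltr_expR oppr_lt0.
have l1 : \int[mu]_(r in `[0, n.+1%:R]) g r @[n --> \oo] --> \int[mu]_(p in `[0, +oo[) g p.
  rewrite setcy_bigcup; apply: cvg_Rintegral_bigcup => //; first exact: setcy_nondecreasing.
  by rewrite -setcy_bigcup; exact: i1.
have l2 : \int[mu]_(r in `[0, n.+1%:R]) gc r @[n --> \oo] --> \int[mu]_(p in `[0, +oo[) gc p.
  rewrite setcy_bigcup; apply: cvg_Rintegral_bigcup => //; first exact: setcy_nondecreasing.
  by rewrite -setcy_bigcup; exact: i2.
have E : \int[mu]_(p in `[0, +oo[) g p = expR (u * Y ^+ 2) * \int[mu]_(p in `[0, +oo[) gc p.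
  have l3 : (expR (u * Y ^+ 2) * \int[mu]_(r in `[0, n.+1%:R]) gc r + rem n.+1%:R)
      @[n --> \oo] --> expR (u * Y ^+ 2) * \int[mu]_(p in `[0, +oo[) gc p + 0.
    by apply: cvgD => //; apply: cvgM => //; exact: cvg_cst.
  rewrite -[RHS]addr0; apply: (cvg_unique _ l1 _) => //.
  rewrite (_ : (fun n => _) = (fun n : nat => expR (u * Y ^+ 2) *
    (\int[mu]_(r in `[0, n.+1%:R]) gc r) + rem n.+1%:R))//.
  by apply/funext => n; exact: rect.
rewrite -/gc (_ : \int[mu]_(p in _) _ = \int[mu]_(p in `[0, +oo[) gc p)//.
have -> : \int[mu]_(p in `[0, +oo[) gc p =
    expR (- (u * Y ^+ 2)) * \int[mu]_(p in `[0, +oo[) g p.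
  by rewrite E mulrA -expRD addNr expR0 mul1r.
rewrite {1}/Rintegral half /= mulrC; congr (_ * expR _).
by rewrite /Y; field; rewrite gt_eqF.
Unshelve. all: end_near. Qed.

End gaussian_cosine.

(** * The contour estimate, away from the branch point *)

Section oscillatory_bound.
Context {R : realType}.
Notation mu := (@lebesgue_measure R).

(** Extending the power w^(a - 1) by zero turns integrals over ranges that depend on another
    variable into integrals over the line, as Fubini's theorem requires. *)
Definition ppow (a w : R) : R := ((fun z => expR ((a - 1) * ln z)) \_ `]0, +oo[) w.

Lemma ppowE (a w : R) : 0 < w -> ppow a w = expR ((a - 1) * ln w).
Proof. by move=> w0; rewrite /ppow patchE mem_set//= in_itv/= w0. Qed.

Lemma ppow_le0 (a w : R) : w <= 0 -> ppow a w = 0.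
Proof.
by move=> w0; rewrite /ppow patchE memNset//= in_itv/= andbT ltNge w0.
Qed.

Lemma ppow_ge0 (a w : R) : 0 <= ppow a w.
Proof.
by have [/ppow_le0 ->//|/ppowE ->] := leP w 0; exact: expR_ge0.
Qed.

Lemma measurable_ppow (a : R) : measurable_fun [set: R] (ppow a).
Proof.
apply/(measurable_restrictT _ _).1 => //.
apply: measurable_funTS; apply: measurableT_comp => //.
by apply: measurable_funM => //; exact: measurable_ln.
Qed.

Lemma integral_ppow_expR (a g : R) : 0 < a ->
  (\int[mu]_w (ppow a w * expR (- (expR g * w)))%:E = (expR (- a * g) * Gamma a)%:E)%E.
Proof.
move=> a0; rewrite -(integral_expR_expR a g a0).
transitivity (\int[mu]_(w in `]0%R, +oo[) (expR ((a - 1) * ln w - expR g * w))%:E)%E.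
  rewrite [RHS]integral_mkcond; apply: eq_integral => w _; rewrite patchE.
  case: ifPn => [/set_mem/=|/negP wn].
    by rewrite in_itv/= andbT => w0; rewrite ppowE// expRD.
  rewrite ppow_le0 ?mul0r// leNgt; apply/negP => w0; apply: wn.
  by rewrite mem_set//= in_itv/= w0.
rewrite ge0_integral_expR; last 2 first.
- by move=> y y0; cts.
- by move=> y y0; exact: expR_ge0.
apply: eq_integral => t _; rewrite -expRD expRK; congr (expR _)%:E; ring.
Qed.

Lemma ln_mul_sqr (c p q : R) : 0 < p -> 0 < q ->
  c * ln (p * q) = c / 2 * (ln (p ^+ 2) + ln (q ^+ 2)).
Proof.
move=> p0 q0; rewrite lnM; [|by rewrite posrE|by rewrite posrE].
have -> : ln (p ^+ 2) = ln p *+ 2 by exact: lnXn.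
have -> : ln (q ^+ 2) = ln q *+ 2 by exact: lnXn.
by move: (ln p) (ln q) => k l; field.
Qed.

(** The right-hand side is exp (L) cos (T) of the contour argument below at [y = 0], left
    unsimplified to match the bottom side of the rectangle. *)
Lemma integrand_at0 (a x t r : R) : 0 < t - r -> 0 < t + r ->
  expR ((a - 1) * ln (t ^+ 2 - r ^+ 2)) * cos (x * r) =
  expR (- (x * 0) + (a - 1) / 2 * (ln ((t - r) ^+ 2 + 0 ^+ 2) + ln ((t + r) ^+ 2 + 0 ^+ 2))) *
  cos (x * r + (a - 1) * (atan (0 / (t + r)) - atan (0 / (t - r)))).
Proof.
move=> p2 p1; rewrite !mul0r mulr0 oppr0 subrr mulr0 addr0 add0r !expr0n/= !addr0.
have -> : t ^+ 2 - r ^+ 2 = (t - r) * (t + r) by ring.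
move: p1 p2; move: (t + r) (t - r) => p q p1 p2.
by rewrite (ln_mul_sqr (a - 1) q p p2 p1).
Qed.

(* Below, exp (L + i T) is e^(i x z) (t ^ 2 - z ^ 2) ^ (a - 1) at z = r + i y, which
   is real on the imaginary axis: only the vertical side Re z = X of the rectangle
   contributes once its height tends to infinity. *)
Lemma oscillatory_bound_lt (a x t X : R) : 0 < a -> a <= 1 -> 0 < x -> 0 < X -> X < t ->
  `|\int[mu]_(r in `[0, X]) (expR ((a - 1) * ln (t ^+ 2 - r ^+ 2)) * cos (x * r))| <=
  expR ((a - 1) * ln (t + X)) * expR (- a * ln x) * Gamma a.
Proof.
move=> a0 a1 x0 X0 Xt.
(* The power is split over t - z and t + z. Both have positive real part on the strip, so their
   arguments are plain arctangents and the branch is the principal one. *)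
pose L (r y : R) := - (x * y) + (a - 1) / 2 * 
  (ln ((t - r) ^+ 2 + y ^+ 2) + ln ((t + r) ^+ 2 + y ^+ 2)).
pose T (r y : R) := x * r + (a - 1) * (atan (y * (t + r)^-1) - atan (y * (t - r)^-1)).
pose P (r y : R) := (a - 1) * ((t + r) / ((t + r) ^+ 2 + y ^+ 2)
  - (t - r) / ((t - r) ^+ 2 + y ^+ 2)).
pose S (r y : R) := x - (a - 1) * (y / ((t + r) ^+ 2 + y ^+ 2) + y / ((t - r) ^+ 2 + y ^+ 2)).
(* [be] lies halfway between [X] and [t]: for |Re z| < [be] both factors have real part above [d],
   which keeps z away from the branch points t and - t. *)
pose be := (X + t) / 2; pose d := (t - X) / 2.
have d0 : 0 < d by rewrite /d; lra.
have Xbe : X < be by rewrite /be; lra.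
have be0 : 0 < be by rewrite /be; lra.
have tr (r : R) : - be < r < be -> d < t + r /\ d < t - r.
  by move=> /andP[r1 r2]; rewrite /d; move: r1 r2; rewrite /be; split; lra.
have sq0 (z y : R) : d < z -> d ^+ 2 <= z ^+ 2 + y ^+ 2.
  by move=> dz; have := sqr_ge0 y; nra.
have sqp (z y : R) : d < z -> 0 < z ^+ 2 + y ^+ 2.
  by move=> dz; apply: lt_le_trans (sq0 z y dz); rewrite exprn_gt0.
have d1 r y : - be < r < be -> is_derive r (1 : R) (L ^~ y) (P r y).
  move=> /tr[h1 h2]; rewrite /L /P; der.
  - exact: sqp.
  - exact: sqp.
  - by have := sqp _ y h1; have := sqp _ y h2 => e1 e2; field; rewrite !gt_eqF.
have d2 r y : - be < r < be -> is_derive y (1 : R) (T r) (P r y).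
  move=> /tr[h1 h2]; have := sqp _ y h1; have := sqp _ y h2 => e1 e2.
  rewrite /T /P; der.
  have h1' : t + r != 0 by rewrite gt_eqF// (lt_trans d0).
  have h2' : t - r != 0 by rewrite gt_eqF// (lt_trans d0).
  have f1 : 1 + (y / (t + r)) ^+ 2 = ((t + r) ^+ 2 + y ^+ 2) / (t + r) ^+ 2 by field.
  have f2 : 1 + (y / (t - r)) ^+ 2 = ((t - r) ^+ 2 + y ^+ 2) / (t - r) ^+ 2 by field.
  by rewrite f1 f2; field; rewrite h1' h2' !gt_eqF.
have d3 r y : - be < r < be -> is_derive r (1 : R) (T ^~ y) (S r y).
  move=> /tr[h1 h2]; have := sqp _ y h1; have := sqp _ y h2 => e1 e2.
  have h1' : t + r != 0 by rewrite gt_eqF// (lt_trans d0).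
  have h2' : t - r != 0 by rewrite gt_eqF// (lt_trans d0).
  rewrite /T /S; der => //.
  have f1 : 1 + (y / (t + r)) ^+ 2 = ((t + r) ^+ 2 + y ^+ 2) / (t + r) ^+ 2 by field.
  have f2 : 1 + (y / (t - r)) ^+ 2 = ((t - r) ^+ 2 + y ^+ 2) / (t - r) ^+ 2 by field.
  by rewrite f1 f2; field; rewrite h1' h2' !gt_eqF.
have d4 r y : - be < r < be -> is_derive y (1 : R) (L r) (- S r y).
  move=> /tr[h1 h2]; rewrite /L /S; der.
  - exact: sqp.
  - exact: sqp.
  - by have := sqp _ y h1; have := sqp _ y h2 => e1 e2; field; rewrite !gt_eqF.
have c1 r : - be < r < be -> continuous (P r).
  by move=> /tr[h1 h2]; rewrite /P; cts; rewrite gt_eqF// sqp.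
have c2 r : - be < r < be -> continuous (S r).
  by move=> /tr[h1 h2]; rewrite /S; cts; rewrite gt_eqF// sqp.
have lnle (r y : R) : - be < r < be ->
    (a - 1) / 2 * (ln ((t - r) ^+ 2 + y ^+ 2) + ln ((t + r) ^+ 2 + y ^+ 2))
    <= (a - 1) * ln (d ^+ 2).
  move=> /tr[h1 h2].
  have l1 : ln (d ^+ 2) <= ln ((t - r) ^+ 2 + y ^+ 2).
    by rewrite ler_ln ?posrE ?exprn_gt0 ?sqp ?sq0.
  have l2 : ln (d ^+ 2) <= ln ((t + r) ^+ 2 + y ^+ 2).
    by rewrite ler_ln ?posrE ?exprn_gt0 ?sqp ?sq0.
  nra.
have Lle (r y : R) : - be < r < be ->
    expR (L r y) <= expR ((a - 1) * ln (d ^+ 2)) * expR (- (x * y)).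
  by move=> rb; rewrite -expRD ler_expR /L addrC lerD2r lnle.
have bd Y (r y : R) : - be < r < be -> 0 <= y <= Y ->
    expR (L r y) * (`|S r y| + `|P r y|) <=
    expR ((a - 1) * ln (d ^+ 2)) * ((x + 2 * Y / d ^+ 2) + 2 / d).
  move=> rb /andP[y0 yY]; apply: ler_pM; rewrite ?expR_ge0 ?addr_ge0//.
    apply: (le_trans (Lle r y rb)); rewrite ler_piMr ?expR_ge0//.
    by rewrite -expR0 ler_expR oppr_le0 mulr_ge0// ltW.
  have [h1 h2] := tr r rb.
  have q0 (z : R) : d < z -> 0 <= y / (z ^+ 2 + y ^+ 2) <= Y / d ^+ 2.
    move=> dz; rewrite divr_ge0 ?(ltW (sqp _ _ _))//= ler_pM ?invr_ge0 ?(ltW (sqp _ _ _))//.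
    by rewrite lef_pV2 ?posrE ?exprn_gt0 ?sqp ?sq0.
  have q1 (z : R) : d < z -> 0 <= z / (z ^+ 2 + y ^+ 2) <= 1 / d.
    move=> dz; have z0 := lt_trans d0 dz.
    rewrite divr_ge0 ?(ltW (sqp _ _ _)) ?(ltW z0)//= ler_pdivrMr ?sqp// mulrAC mul1r.
    by rewrite ler_pdivlMr//; have := sqr_ge0 y; nra.
  have scale (k K : R) : 0 <= k <= K -> 0 <= (1 - a) * k <= K.
    move=> /andP[k0 kK]; rewrite mulr_ge0 ?subr_ge0//= (le_trans _ kK)//.
    by rewrite ler_piMl// lerBlDr lerDl ltW.
  have /andP[s1 s2] := scale _ _ (q0 _ h1); have /andP[s3 s4] := scale _ _ (q0 _ h2).
  have /andP[s5 s6] := scale _ _ (q1 _ h1); have /andP[s7 s8] := scale _ _ (q1 _ h2).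
  apply: lerD; rewrite ler_norml.
    rewrite /S (_ : x - _ = x + ((1 - a) * (y / ((t + r) ^+ 2 + y ^+ 2)) +
      (1 - a) * (y / ((t - r) ^+ 2 + y ^+ 2)))); last by ring.
    rewrite -(mulrA 2); move: s1 s2 s3 s4.
    move: ((1 - a) * _) ((1 - a) * _) (Y / _) => k1 k2 K *; apply/andP; split; lra.
  rewrite /P (_ : (a - 1) * _ = ((1 - a) * ((t - r) / ((t - r) ^+ 2 + y ^+ 2)) -
      (1 - a) * ((t + r) / ((t + r) ^+ 2 + y ^+ 2)))); last by ring.
  rewrite (_ : 2 / d = 2 * (1 / d)); last by rewrite mul1r.
  move: s5 s6 s7 s8.
  move: ((1 - a) * _) ((1 - a) * _) (1 / _) => k1 k2 K *; apply/andP; split; lra.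
have inX r : 0 <= r <= X -> - be < r < be.
  by move=> /andP[r0 rX]; apply/andP; split; lra.
(* [K0] times exp (- x Y) bounds the top side of the rectangle; [C] bounds the vertical side Re z =
   X for every height. *)
pose K0 := X * expR ((a - 1) * ln (d ^+ 2)).
pose C := expR ((a - 1) * ln (t + X)) * expR (- a * ln x) * Gamma a.
have cL r : - be < r < be -> continuous (L r).
  by move=> rb y; exact: is_derive_continuous _ _ _ (d4 r y rb).
have cT r : - be < r < be -> continuous (T r).
  by move=> rb y; exact: is_derive_continuous _ _ _ (d2 r y rb).
have mX : - be < X < be by apply: inX; rewrite lexx ltW.
have m0 : - be < 0 < be by apply: inX; rewrite lexx ltW.
have bound Y : 0 < Y ->
    `|\int[mu]_(r in `[0, X]) (expR ((a - 1) * ln (t ^+ 2 - r ^+ 2)) * cos (x * r))| <=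
    K0 * expR (- (x * Y)) + C.
  move=> Y0.
  have nbe0 : - be < 0 by rewrite oppr_lt0.
  have H := cauchy_rectangle L T P S (- be) be X Y _ nbe0 X0 Xbe Y0 d1 d2 d3 d4 c1 c2 (bd Y).
  have -> : \int[mu]_(r in `[0, X]) (expR ((a - 1) * ln (t ^+ 2 - r ^+ 2)) * cos (x * r)) =
      \int[mu]_(r in `[0, X]) (expR (L r 0) * cos (T r 0)).
    apply: eq_Rintegral => r /set_mem/=; rewrite in_itv/= => /inX/tr[h1 h2].
    exact: (integrand_at0 _ _ _ _ (lt_trans d0 h2) (lt_trans d0 h1)).
  rewrite {}H.
  have -> : \int[mu]_(y in `[0, Y]) (expR (L 0 y) * sin (T 0 y)) = 0.
    rewrite (_ : (fun y : R => _) = cst 0) ?Rintegral_cst//= ?mul0r//.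
    by apply/funext => y; rewrite /T addr0 subr0 subrr !mulr0 add0r sin0 mulr0.
  rewrite subr0 (le_trans (ler_normD _ _))//; apply: lerD.
    have ci : mu.-integrable `[0, X] (EFin \o (fun r : R => expR (L r Y) * cos (T r Y))).
      apply: continuous_compact_integrable; first exact: segment_compact.
      apply: continuous_in_subspaceT => r /set_mem/=; rewrite in_itv/= => /inX rb.
      have e1 := is_derive_continuous _ _ _ (d1 r Y rb).
      have e2 := is_derive_continuous _ _ _ (d3 r Y rb).
      apply: (contM (fun r => expR (L r Y)) (fun r => cos (T r Y))).
        by apply: (cont_comp expR (L ^~ Y)) => //; exact: continuous_expR.
      by apply: (cont_comp cos (T ^~ Y)) => //; exact: continuous_cos.
    apply: (le_trans (le_normr_Rintegral _ ci)); first exact: measurable_itv.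
    pose k := expR ((a - 1) * ln (d ^+ 2)) * expR (- (x * Y)).
    apply: (@le_trans _ _ (\int[mu]_(r in `[0, X]) (cst k r))).
      apply: le_Rintegral => //; first exact: integrable_norm.
        apply: continuous_compact_integrable; first exact: segment_compact.
        by apply: continuous_subspaceT => ?; exact: cvg_cst.
      move=> r; rewrite /= in_itv/= => /inX rb.
      rewrite normrM (ger0_norm (expR_ge0 _)) -[leRHS]mulr1.
      apply: ler_pM; [exact: expR_ge0|exact: normr_ge0| |by rewrite ler_norml cos_geN1 cos_le1].
      exact: Lle.
    rewrite Rintegral_cst//= lebesgue_measure_itv/= lte_fin X0 /= oppr0 addr0 /k /K0.
    by rewrite mulrC mulrA.
  have ci : mu.-integrable `[0, Y] (EFin \o (fun y : R => expR (L X y) * sin (T X y))).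
    apply: continuous_compact_integrable; first exact: segment_compact.
    apply: continuous_subspaceT => y; 
      apply: (contM (fun y => expR (L X y)) (fun y => sin (T X y))).
      by apply: (cont_comp expR (L X)); [exact: cL|exact: continuous_expR].
    by apply: (cont_comp sin (T X)); [exact: cT|exact: continuous_sin].
  rewrite -lee_fin EFin_normr_Rintegral//.
  apply: (le_trans (le_abse_integral _ _ _)) => //; first by case/integrableP: ci.
  (* [C] is written back as the Gamma integral of (t + X)^(a - 1) w^(a - 1) exp (- x w), which
     dominates the vertical side pointwise. *)
  have -> : (C%:E = \int[mu]_w ((expR ((a - 1) * ln (t + X)))%:E *
      (ppow a w * expR (- (expR (ln x) * w)))%:E))%E.
    rewrite ge0_integralZl_EFin; [|by []| | |exact: expR_ge0]; last 2 first.
    - by move=> w _; rewrite lee_fin mulr_ge0 ?ppow_ge0 ?expR_ge0.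
    - apply/measurable_EFinP; apply: measurable_funM; first exact: measurable_ppow.
      by apply: measurableT_comp => //; apply: measurableT_comp => //; exact: measurable_funM.
    by rewrite integral_ppow_expR// -EFinM mulrA.
  have mv : measurable_fun [set: R] (fun y => expR (L X y) * sin (T X y)).
    apply: continuous_measurable_fun => y; 
      apply: (contM (fun y => expR (L X y)) (fun y => sin (T X y))).
      by apply: (cont_comp expR (L X)); [exact: cL|exact: continuous_expR].
    by apply: (cont_comp sin (T X)); [exact: cT|exact: continuous_sin].
  have mC : measurable_fun [set: R] (fun w => ((expR ((a - 1) * ln (t + X)))%:E *
      (ppow a w * expR (- (expR (ln x) * w)))%:E)%E).
    apply: measurable_funeM; apply/measurable_EFinP.
    apply: measurable_funM; first exact: measurable_ppow.
    by apply: measurableT_comp => //; apply: measurableT_comp => //; exact: measurable_funM.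
  have C0 w : (0 <= (expR ((a - 1) * ln (t + X)))%:E *
      (ppow a w * expR (- (expR (ln x) * w)))%:E)%E.
    by rewrite -EFinM lee_fin !mulr_ge0 ?ppow_ge0 ?expR_ge0.
  have mv' : measurable_fun [set: R] (fun y => `|(expR (L X y) * sin (T X y))%:E|%E).
    by apply: measurableT_comp => //; exact/measurable_EFinP.
  rewrite -integral_itv_obnd_cbnd; last exact: measurable_funTS.
  apply: (@le_trans _ _ (\int[mu]_(w in `]0%R, Y]) ((expR ((a - 1) * ln (t + X)))%:E *
      (ppow a w * expR (- (expR (ln x) * w)))%:E))%E); last first.
    by apply: ge0_subset_integral => //.
  apply: ge0_le_integral; [by []|by []|exact: measurable_funTS|exact: measurable_funTS|].
  move=> y /=; rewrite in_itv/= => /andP[y0 _].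
  rewrite lee_fin normrM (ger0_norm (expR_ge0 _)).
  apply: (@le_trans _ _ (expR (L X y))).
    by rewrite ler_piMr ?expR_ge0// ler_norml sin_geN1 sin_le1.
  rewrite ppowE// lnK ?posrE// -!expRD ler_expR /L.
  have [h1 h2] := tr X mX.
  (* On Re z = X, |t - z| >= y and |t + z| >= t + X; the exponent a - 1 <= 0 reverses both
     inequalities. *)
  have l1 : 2 * ln y <= ln ((t - X) ^+ 2 + y ^+ 2).
    have -> : 2 * ln y = ln (y ^+ 2) by rewrite mulr_natl; apply/esym; exact: lnXn.
    rewrite ler_ln; [by rewrite lerDr sqr_ge0|by rewrite posrE exprn_gt0|].
    by rewrite posrE; exact: sqp.
  have tX0 : 0 < t + X by exact: lt_trans h1.
  have l2 : 2 * ln (t + X) <= ln ((t + X) ^+ 2 + y ^+ 2).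
    have -> : 2 * ln (t + X) = ln ((t + X) ^+ 2) by rewrite mulr_natl; apply/esym; exact: lnXn.
    rewrite ler_ln; [by rewrite lerDl sqr_ge0|by rewrite posrE exprn_gt0|].
    by rewrite posrE; exact: sqp.
  move: l1 l2; move: (ln y) (ln (t + X)) (ln (_ + _)) (ln (_ + _)) => k1 k2 k3 k4 l1 l2.
  nra.
apply/ler_addgt0Pr => e e0.
have K00 : 0 <= K0 by rewrite mulr_ge0 ?expR_ge0// ltW.
(* At this height exp (x Y) >= x Y >= K0 / e, so the top side is at most [e]; the summand 1 keeps
   the height positive. *)
have Y0 : 0 < K0 / (e * x) + 1 by rewrite ltr_wpDl// divr_ge0// ltW// mulr_gt0.
apply: (le_trans (bound _ Y0)); rewrite addrC lerD2l expRN ler_pdivrMr ?expR_gt0//.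
apply: (@le_trans _ _ (e * (x * (K0 / (e * x) + 1)))).
  rewrite (_ : e * _ = K0 + e * x); last by field; rewrite !gt_eqF.
  by rewrite lerDl mulr_ge0// ltW.
rewrite ler_pM2l// (le_trans _ (expR_ge1Dx _))// lerDr//.
Qed.

End oscillatory_bound.

(** * The Poisson integral: integrability and bound *)

Section oscillatory_integral.
Context {R : realType}.
Notation mu := (@lebesgue_measure R).

Definition cos_half (x p : R) : R := ((fun z => cos (x * z)) \_ `[0, +oo[) p.

(** For s = t^2 with t > 0 this is (sqrt(pi) / 2) Gamma(a) (2 t / x)^(a - 1/2) J_{a - 1/2}(x t),
    when a > 0 and x > 0. *)
Definition osc (a x s : R) : R := \int[mu]_p (ppow a (s - p ^+ 2) * cos_half x p).

Lemma normr_cos_half (x p : R) : `|cos_half x p| <= 1.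
Proof.
rewrite /cos_half patchE; case: ifPn => _; last by rewrite normr0.
by rewrite ler_norml cos_geN1 cos_le1.
Qed.

Lemma measurable_cos_half (x : R) : measurable_fun [set: R] (cos_half x).
Proof.
apply/(measurable_restrictT _ _).1 => //.
by apply: measurable_funTS; apply: continuous_measurable_fun; cts.
Qed.

Lemma osc_integrandE (a x t p : R) : 0 < t ->
  ppow a (t ^+ 2 - p ^+ 2) * cos_half x p =
  ((fun r => expR ((a - 1) * ln (t ^+ 2 - r ^+ 2)) * cos (x * r)) \_ `[0, t[) p.
Proof.
move=> t0; rewrite /cos_half !patchE.
have [p0|p0] := leP 0 p; last first.
  rewrite memNset ?mulr0 ?memNset//= in_itv/= ?andbT; first by rewrite leNgt p0.
  by rewrite leNgt p0.
rewrite mem_set/= ?in_itv/= ?p0//.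
have [pt|tp] := ltP p t.
  rewrite mem_set/= ?in_itv/= ?p0// ppowE//.
  by rewrite subr_gt0 ltrXn2r// nnegrE ltW.
rewrite memNset/= ?in_itv/= ?p0/= -?leNgt//.
  by rewrite ppow_le0 ?mul0r// subr_le0 lerXn2r// nnegrE// ltW.
by rewrite ltNge tp.
Qed.

(** Halving the harmonic sequence keeps the right endpoints positive already at n = 0, since the
    contour estimate asks for 0 < X. *)
Lemma setco_bigcup (t : R) : 0 < t ->
  `[0, t[%classic = \bigcup_n `[0, t * (1 - harmonic n / 2)]%classic.
Proof.
move=> t0; apply/seteqP; split => p /=; rewrite in_itv/=.
  move=> /andP[p0 pt].
  have h : 0 < (t - p) / t by rewrite divr_gt0// subr_gt0.
  have [n _ hn] := near_infty_natSinv_lt (PosNum h).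
  exists n => //=; rewrite in_itv/= p0/=.
  have := hn n (leqnn n); rewrite /harmonic /= => hn'.
  have : t * n.+1%:R^-1 < t - p by rewrite -ltr_pdivlMl// mulrC.
  have : 0 < n.+1%:R^-1 :> R by rewrite invr_gt0.
  move: (n.+1%:R^-1) => k k0 ktp; have : 0 < t * k by rewrite mulr_gt0.
  lra.
move=> [n _ /=]; rewrite in_itv/= => /andP[-> pn]/=; apply: (le_lt_trans pn).
by rewrite gtr_pMr// gtrBl divr_gt0// harmonic_gt0.
Qed.

(** The Gamma integrand reflected by p -> t - p: an integrable model of the endpoint singularity (t
    - p)^(a - 1). *)
Lemma integrable_ppow_flip (a t : R) : 0 < a ->
  mu.-integrable [set: R] (fun p => (ppow a (t - p) * expR (- (t - p)))%:E).
Proof.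
move=> a0.
have mF : measurable_fun [set: R] (fun w => (ppow a w * expR (- (expR 0 * w)))%:E).
  apply/measurable_EFinP; apply: measurable_funM; first exact: measurable_ppow.
  by apply: continuous_measurable_fun; cts.
have F0 w : (0 <= (ppow a w * expR (- (expR 0 * w)))%:E)%E.
  by rewrite lee_fin mulr_ge0 ?ppow_ge0 ?expR_ge0.
have mG : measurable_fun [set: R] (fun w => (ppow a (- w) * expR (- (expR 0 * - w)))%:E).
  exact: (measurableT_comp mF (@oppr_measurable _ setT)).
apply/integrableP; split.
  apply/measurable_EFinP; apply: measurable_funM; last first.
    by apply: continuous_measurable_fun; cts.
  by apply: measurableT_comp; [exact: measurable_ppow|exact: measurable_funB].
rewrite (_ : (\int[mu]_p _)%E = (expR (- a * 0) * Gamma a)%:E) ?ltry//.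
rewrite -(integral_ppow_expR a 0 a0) -(ge0_integral_opp _ mF F0).
rewrite -(ge0_integral_shift (- t) _ mG); last by move=> w; exact: F0.
apply: eq_integral => p _; rewrite gee0_abs; last first.
  by rewrite lee_fin mulr_ge0 ?ppow_ge0 ?expR_ge0.
by rewrite expR0 mul1r (opprB p t).
Qed.

(** On [[0, t[], t^2 - p^2 >= t (t - p) and a <= 1 give the majorant t^(a - 1) (t - p)^(a - 1). The
    factors exp t and exp (- (t - p)), whose product exp p is at least 1, bring it to the reflected
    Gamma integrand. *)
Lemma integrable_osc (a x s : R) : 0 < a -> a <= 1 -> 0 < s ->
  mu.-integrable [set: R] (fun p => (ppow a (s - p ^+ 2) * cos_half x p)%:E).
Proof.
move=> a0 a1 s0; set t := Num.sqrt s.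
have t0 : 0 < t by rewrite sqrtr_gt0.
have -> : s = t ^+ 2 by rewrite sqr_sqrtr// ltW.
apply: (@le_integrable _ _ _ mu _ measurableT _
   (fun p => ((expR ((a - 1) * ln t) * expR t)%:E * (ppow a (t - p) * expR (- (t - p)))%:E)%E)).
- apply/measurable_EFinP; apply: measurable_funM; last exact: measurable_cos_half.
  by apply: measurableT_comp; [exact: measurable_ppow|exact: measurable_funB].
- move=> p _; rewrite lee_fin osc_integrandE// patchE.
  case: ifPn => [/set_mem/=|_]; last by rewrite normr0.
  rewrite in_itv/= => /andP[p0 pt].
  apply: (le_trans _ (ler_norm _)); rewrite normrM (ger0_norm (expR_ge0 _)).
  apply: (@le_trans _ _ (expR ((a - 1) * ln (t ^+ 2 - p ^+ 2)))).
    by rewrite ler_piMr ?expR_ge0// ler_norml cos_geN1 cos_le1.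
  have tp0 : 0 < t - p by rewrite subr_gt0.
  rewrite ppowE// -!expRD ler_expR.
  have : ln (t ^+ 2 - p ^+ 2) >= ln (t * (t - p)).
    rewrite ler_ln ?posrE ?mulr_gt0//; last by nra.
    by nra.
  rewrite lnM ?posrE//.
  move: (ln _) (ln _) (ln _) => k1 k2 k3.
  nra.
- by apply: integrableZl => //; exact: integrable_ppow_flip.
Qed.

(** The branch point t = sqrt s is reached only in the limit X -> t of the contour estimate, where
    (t + X)^(a - 1) becomes (2 t)^(a - 1). *)
Lemma osc_bound (a x s : R) : 0 < a -> a <= 1 -> 0 < x -> 0 < s ->
  `|osc a x s| <= expR ((a - 1) * (ln 2 + ln s / 2)) * expR (- a * ln x) * Gamma a.
Proof.
move=> a0 a1 x0 s0; have := integrable_osc a x s a0 a1 s0; rewrite /osc.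
set t := Num.sqrt s.
have t0 : 0 < t by rewrite sqrtr_gt0.
have st : s = t ^+ 2 by rewrite sqr_sqrtr// ltW.
have -> : ln s / 2 = ln t.
  have -> : ln s = ln t *+ 2 by rewrite st; exact: lnXn.
  by move: (ln t) => k; rewrite mulr2n; field.
rewrite -lnM ?posrE// st.
pose f (r : R) := expR ((a - 1) * ln (t ^+ 2 - r ^+ 2)) * cos (x * r).
have -> : (fun p => (ppow a (t ^+ 2 - p ^+ 2) * cos_half x p)%:E) =
    (fun p => ((f \_ `[0, t[) p)%:E).
  by apply/funext => p; rewrite osc_integrandE.
rewrite (_ : \int[mu]_p _ = \int[mu]_(p in `[0, t[) f p); last first.
  by rewrite [RHS]Rintegral_mkcond; apply: eq_Rintegral => p _; rewrite osc_integrandE.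
move=> fi; pose X n := t * (1 - harmonic n / 2).
have hle n : harmonic n <= 1 :> R by rewrite /harmonic/= invf_le1 ?ler1n.
have X0 n : 0 < X n by rewrite mulr_gt0//; have := hle n; lra.
have Xt n : X n < t by rewrite gtr_pMr// gtrBl divr_gt0// harmonic_gt0.
have cX : X n @[n --> \oo] --> t.
  rewrite -[X in _ --> X]mulr1; apply: cvgM; first exact: cvg_cst.
  rewrite -[X in _ --> X]subr0; apply: cvgB; first exact: cvg_cst.
  rewrite -(mul0r (2^-1)); apply: cvgM; last exact: cvg_cst.
  exact: cvg_harmonic.
have l1 : \int[mu]_(p in `[0, X n]) f p @[n --> \oo] --> \int[mu]_(p in `[0, t[) f p.
  rewrite (setco_bigcup t t0); apply: cvg_Rintegral_bigcup.
  - apply/nondecreasing_seqP => n; rewrite subsetEset; apply: subset_itv; rewrite bnd_simp//.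
    rewrite ler_pM2l// lerD2l lerN2 ler_pM2r// /harmonic/=.
    by rewrite lef_pV2 ?posrE// ler_nat.
  - by move=> n; exact: measurable_itv.
  - rewrite -(setco_bigcup t t0).
    by apply/integrable_mkcond => //; rewrite restrict_EFin.
have l2 : expR ((a - 1) * ln (t + X n)) * expR (- a * ln x) * Gamma a @[n --> \oo] -->
    expR ((a - 1) * ln (2 * t)) * expR (- a * ln x) * Gamma a.
  apply: cvgM; last exact: cvg_cst.
  apply: cvgM; last exact: cvg_cst.
  have c : {for t, continuous (fun z : R => expR ((a - 1) * ln (t + z)))}.
    by cts; rewrite addr_gt0.
  have := cvg_comp _ _ cX c; rewrite (_ : t + t = 2 * t)//; ring.
apply: (ler_cvg_to (cvg_norm l1) l2); near=> n.
exact: oscillatory_bound_lt.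
Unshelve. all: end_near. Qed.

End oscillatory_integral.

(** * The Laplace transform of the Poisson integral *)

Section laplace_transform.
Context {R : realType}.
Notation mu := (@lebesgue_measure R).

Lemma osc_le0 (a x s : R) : s <= 0 -> osc a x s = 0.
Proof.
move=> s0; rewrite /osc (_ : (fun p => _) = cst 0).
  by rewrite /Rintegral integral0_eq.
by apply/funext => p; rewrite ppow_le0 ?mul0r// subr_le0 (le_trans s0)// sqr_ge0.
Qed.

Lemma measurable_ppow_shift (a g p : R) :
  measurable_fun [set: R] (fun s => ppow a (s - p ^+ 2) * expR (- (expR g * s))).
Proof.
apply: measurable_funM; last by apply: continuous_measurable_fun; cts.
by apply: measurableT_comp; [exact: measurable_ppow|exact: measurable_funB].
Qed.

Lemma integral_ppow_shift (a g p : R) : 0 < a ->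
  (\int[mu]_s (ppow a (s - p ^+ 2) * expR (- (expR g * s)))%:E =
   (expR (- (expR g * p ^+ 2)) * (expR (- a * g) * Gamma a))%:E)%E.
Proof.
move=> a0.
have mF : measurable_fun [set: R]
    (fun w => (ppow a w * expR (- (expR g * (w + p ^+ 2))))%:E).
  apply/measurable_EFinP; apply: measurable_funM; first exact: measurable_ppow.
  by apply: continuous_measurable_fun; cts.
have F0 w : (0 <= (ppow a w * expR (- (expR g * (w + p ^+ 2))))%:E)%E.
  by rewrite lee_fin mulr_ge0 ?ppow_ge0 ?expR_ge0.
transitivity (\int[mu]_w (ppow a w * expR (- (expR g * (w + p ^+ 2))))%:E)%E.
  rewrite -(ge0_integral_shift (- p ^+ 2) _ mF F0).
  by apply: eq_integral => s _; rewrite subrK.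
rewrite EFinM -(integral_ppow_expR a g a0) -ge0_integralZl_EFin; [|by []| | |exact: expR_ge0].
- apply: eq_integral => w _; rewrite -EFinM mulrDr opprD expRD; congr (_%:E); ring.
- by move=> w _; rewrite lee_fin mulr_ge0 ?ppow_ge0 ?expR_ge0.
- apply/measurable_EFinP; apply: measurable_funM; first exact: measurable_ppow.
  by apply: continuous_measurable_fun; cts.
Qed.

Lemma measurable_osc_kernel (a g x : R) : measurable_fun [set: R * R]
  (fun z : R * R => (ppow a (z.1 - z.2 ^+ 2) * expR (- (expR g * z.1)) * cos_half x z.2)%:E).
Proof.
apply/measurable_EFinP; apply: measurable_funM.
  apply: measurable_funM.
    apply: measurableT_comp; first exact: measurable_ppow.
    apply: measurable_funB; first exact: measurable_fst.
    by apply: measurable_funX; exact: measurable_snd.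
  do 2 apply: measurableT_comp => //.
  by apply: measurable_funM => //; exact: measurable_fst.
by apply: measurableT_comp; [exact: measurable_cos_half|exact: measurable_snd].
Qed.

(** Absolute values are integrated in s first: a shifted Gamma integral leaves a multiple of a
    Gaussian in p. *)
Lemma integrable_osc_kernel (a g x : R) : 0 < a ->
  (mu \x mu)%E.-integrable [set: R * R]
  (fun z : R * R => (ppow a (z.1 - z.2 ^+ 2) * expR (- (expR g * z.1)) * cos_half x z.2)%:E).
Proof.
move=> a0; apply/integrable21ltyP; first exact: measurable_osc_kernel.
have C0 : 0 <= expR (- a * g) * Gamma a by rewrite mulr_ge0 ?expR_ge0// ltW// Gamma_gt0.
apply: (@le_lt_trans _ _ (\int[mu]_(p in `[0%R, +oo[)
    ((expR (- a * g) * Gamma a)%:E * (expR (- (expR (g / 2) ^+ 2 * p ^+ 2)))%:E))%E); last first.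
  rewrite ge0_integralZl_EFin; [|by []| | |exact: C0].
  - by rewrite integral_gauss_half ?expR_gt0// -EFinM ltry.
  - by move=> w _; rewrite lee_fin expR_ge0.
  - by apply/measurable_EFinP; apply: measurable_funTS; apply: continuous_measurable_fun; cts.
rewrite [leRHS]integral_mkcond; apply: ge0_le_integral => //.
- by move=> p _; apply: integral_ge0.
- apply: (measurable_fun_fubini_tonelli_G (m1 := mu) (fun z : R * R =>
    `|(ppow a (z.1 - z.2 ^+ 2) * expR (- (expR g * z.1)) * cos_half x z.2)%:E|%E)) => //.
  by apply: measurableT_comp => //; exact: measurable_osc_kernel.
- apply/(measurable_restrictT _ _).1 => //; apply: measurable_funTS.
  by apply: measurable_funeM; apply/measurable_EFinP; apply: continuous_measurable_fun; cts.
move=> p _; rewrite patchE; case: ifPn => [_|pn]; last first.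
  have e : cos_half x p = 0 by rewrite /cos_half patchE (negbTE pn).
  by rewrite integral0_eq// => s _ /=; rewrite e mulr0 normr0.
rewrite -EFinM mulrC (_ : expR (g / 2) ^+ 2 = expR g); last first.
  by rewrite -expRM_natl; congr expR; field.
rewrite -(integral_ppow_shift a g p a0); apply: ge0_le_integral => //.
- apply: measurableT_comp => //; apply/measurable_EFinP.
  by apply: measurable_funM; [exact: measurable_ppow_shift|exact: (measurable_cst (cos_half x p))].
- by apply/measurable_EFinP; exact: measurable_ppow_shift.
move=> s _ /=; rewrite lee_fin normrM ger0_norm ?mulr_ge0 ?ppow_ge0 ?expR_ge0//.
by rewrite ler_piMr ?mulr_ge0 ?ppow_ge0 ?expR_ge0// normr_cos_half.
Qed.

Lemma integral_osc_kernel (a g x s : R) : 0 < a -> a <= 1 ->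
  (\int[mu]_p (ppow a (s - p ^+ 2) * expR (- (expR g * s)) * cos_half x p)%:E =
  (expR (- (expR g * s)) * osc a x s)%:E)%E.
Proof.
move=> a0 a1; have [s0|s0] := leP s 0.
  rewrite osc_le0// mulr0 integral0_eq// => p _.
  by rewrite ppow_le0 ?mul0r// subr_le0 (le_trans s0)// sqr_ge0.
have i := integrable_osc a x s a0 a1 s0.
rewrite EFinM /osc /Rintegral fineK; last exact: integrable_fin_num.
rewrite -integralZl//; apply: eq_integral => p _; rewrite -EFinM; congr (_%:E); ring.
Qed.

(** Fubini's theorem yields measurability of exp (- s) times [osc], the damping being what makes the
    kernel integrable on the plane; it is then divided out. *)
Lemma measurable_osc (a x : R) : 0 < a -> a <= 1 -> measurable_fun [set: R] (osc a x).
Proof.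
move=> a0 a1.
have := measurable_fubini_F (integrable_osc_kernel a 0 x a0).
rewrite /fubini_F => m.
have {}m : measurable_fun [set: R] (fun s => (expR (- (expR 0 * s)) * osc a x s)%:E).
  by apply: eq_measurable_fun m => s _; exact: integral_osc_kernel.
rewrite (_ : osc a x = (fun s => expR (expR 0 * s) * (expR (- (expR 0 * s)) * osc a x s))).
  apply: measurable_funM; first by apply: continuous_measurable_fun; cts.
  exact/measurable_EFinP.
by apply/funext => s; rewrite mulrA -expRD subrr expR0 mul1r.
Qed.

Lemma laplace_osc (a x g : R) : 0 < a -> a <= 1 -> 0 < x ->
  \int[mu]_s (expR (- (expR g * s)) * osc a x s) =
  expR (- a * g) * Gamma a *
  (Num.sqrt pi / expR (g / 2) / 2 * expR (- (x ^+ 2 / (4 * expR g)))).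
Proof.
move=> a0 a1 x0; have i := integrable_osc_kernel a g x a0.
have := Fubini i => /= F.
have L : (\int[mu]_s (expR (- (expR g * s)) * osc a x s)%:E =
    \int[mu]_p (expR (- (expR g * p ^+ 2)) * (expR (- a * g) * Gamma a) * cos_half x p)%:E)%E.
  transitivity (\int[mu]_s \int[mu]_p
    (ppow a (s - p ^+ 2) * expR (- (expR g * s)) * cos_half x p)%:E)%E.
    by apply: eq_integral => s _; apply/esym; exact: integral_osc_kernel.
  rewrite F; apply: eq_integral => p _.
  have mk : mu.-integrable [set: R] (fun s => (ppow a (s - p ^+ 2) * expR (- (expR g * s)))%:E).
    apply/integrableP; split.
      by apply/measurable_EFinP; exact: measurable_ppow_shift.
    apply: (@le_lt_trans _ _ (\int[mu]_s (ppow a (s - p ^+ 2) * expR (- (expR g * s)))%:E)%E);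
      last by rewrite (integral_ppow_shift a g p a0) ltry.
    rewrite le_eqVlt; apply/orP; left; apply/eqP; apply: eq_integral => s _.
    by apply: gee0_abs; rewrite lee_fin mulr_ge0 ?ppow_ge0 ?expR_ge0.
  rewrite [RHS]EFinM -(integral_ppow_shift a g p a0) muleC -integralZl; [|by []|exact: mk].
  by apply: eq_integral => s _; rewrite -EFinM mulrC.
rewrite {1}/Rintegral L.
have e2 : expR g = expR (g / 2) ^+ 2 by rewrite -expRM_natl; congr expR; field.
transitivity (\int[mu]_(p in `[0, +oo[) (expR (- a * g) * Gamma a *
    (expR (- (expR (g / 2) ^+ 2 * p ^+ 2)) * cos (x * p)))).
  rewrite Rintegral_mkcond /Rintegral; congr fine; apply: eq_integral => p _.
  rewrite /cos_half !patchE -e2; case: ifPn => _; congr (_%:E); last by rewrite mulr0.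
  by ring.
rewrite RintegralZl; [|by []|apply: integrable_gauss_cos; exact: expR_gt0].
by rewrite (Rintegral_gauss_cos _ _ (expR_gt0 _) x0) -e2.
Qed.

End laplace_transform.

(** * The modulus of the complex Gamma function and the integral of K_{i tau} *)

Section cGamma_and_macdonald.
Context {R : realType}.
Notation mu := (@lebesgue_measure R).

Lemma cGammaE (b tau : R) : cGamma (b +i* tau) =
  (\int[mu]_t (expR (b * t - expR t) * cos (tau * t))) +i*
  (\int[mu]_t (expR (b * t - expR t) * sin (tau * t))).
Proof.
have cp y : 0 < y -> {for y, continuous (fun t : R => t `^ (b - 1))}.
  by move=> y0; exact: is_derive_continuous _ _ _ (is_derive1_powR (b - 1) y0).
rewrite /cGamma; congr (_ +i* _).
- transitivity (\int[mu]_(t in `]0, +oo[) (t `^ (b - 1) * (cos (tau * ln t) * expR (- t)))).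
    by apply: eq_Rintegral => t _ /=; rewrite subr0 mulr0 subr0 mulrA.
  rewrite Rintegral_expR.
    apply: eq_Rintegral => t _; rewrite expRK -expRM.
    rewrite (_ : b * t - expR t = t * (b - 1) + - expR t + t); last by ring.
    by rewrite !expRD; ring.
  move=> y y0; apply: (contM (fun t => t `^ (b - 1))); first exact: cp.
  by cts.
- transitivity (\int[mu]_(t in `]0, +oo[) (t `^ (b - 1) * (sin (tau * ln t) * expR (- t)))).
    by apply: eq_Rintegral => t _ /=; rewrite subr0 mulr0 add0r mulrA.
  rewrite Rintegral_expR.
    apply: eq_Rintegral => t _; rewrite expRK -expRM.
    rewrite (_ : b * t - expR t = t * (b - 1) + - expR t + t); last by ring.
    by rewrite !expRD; ring.
  move=> y y0; apply: (contM (fun t => t `^ (b - 1))); first exact: cp.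
  by cts.
Qed.

Lemma integrable_Gamma_trig (b c : R) (f : R -> R) : 0 < b -> 0 < c ->
  continuous f -> (forall t, `|f t| <= 1) ->
  mu.-integrable [set: R] (EFin \o (fun t => expR (b * t - c * expR t) * f t)).
Proof.
move=> b0 c0 cf f1.
apply: (le_integrable _ _ _ (integrable_expR_expR b c b0 c0)) => //.
  apply/measurable_EFinP; apply: measurable_funM; last exact: continuous_measurable_fun.
  by apply: continuous_measurable_fun; cts.
by move=> t _; rewrite lee_fin normrM ler_piMr.
Qed.

(** The left side is the modulus of the real part of (c - i s) (A + i B); the defect of the squares
    is (c B - s A)^2. *)
Lemma norm_combo_le (c s A B : R) : c ^+ 2 + s ^+ 2 = 1 ->
  `|c * A + s * B| <= Num.sqrt (A ^+ 2 + B ^+ 2).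
Proof.
move=> cs; rewrite -sqrtr_sqr ler_wsqrtr//.
rewrite (_ : A ^+ 2 + B ^+ 2 = (c ^+ 2 + s ^+ 2) * (A ^+ 2 + B ^+ 2)); last by rewrite cs mul1r.
have := sqr_ge0 (c * B - s * A); lra.
Qed.

(** Translating by [g] turns the integral into exp (- b g) Re (exp (- i d) Gamma(b + i tau)) with d
    = tau (g + k): both the scale and [k] affect only the phase beyond the factor exp (- b g). *)
Lemma cGamma_scale_bound (b tau g k : R) : 0 < b ->
  `|\int[mu]_t (expR (b * t - expR g * expR t) * cos (tau * (t - k)))| <=
  expR (- b * g) * ComplexField.Normc.normc (cGamma (b +i* tau)).
Proof.
move=> b0; rewrite cGammaE /=.
set A := \int[mu]_t (expR (b * t - expR t) * cos (tau * t)).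
set B := \int[mu]_t (expR (b * t - expR t) * sin (tau * t)).
pose d := tau * (g + k).
pose F t := expR (b * t - expR g * expR t) * cos (tau * (t - k)).
have mF : measurable_fun [set: R] F by apply: continuous_measurable_fun; rewrite /F; cts.
have i1 : mu.-integrable [set: R] (EFin \o (fun t => expR (b * t - 1 * expR t) * cos (tau * t))).
  apply: integrable_Gamma_trig => //; first by cts.
  by move=> t; rewrite ler_norml cos_geN1 cos_le1.
have i2 : mu.-integrable [set: R] (EFin \o (fun t => expR (b * t - 1 * expR t) * sin (tau * t))).
  apply: integrable_Gamma_trig => //; first by cts.
  by move=> t; rewrite ler_norml sin_geN1 sin_le1.
have AE : A = \int[mu]_t (expR (b * t - 1 * expR t) * cos (tau * t)).
  by apply: eq_Rintegral => t _; rewrite mul1r.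
have BE : B = \int[mu]_t (expR (b * t - 1 * expR t) * sin (tau * t)).
  by apply: eq_Rintegral => t _; rewrite mul1r.
have -> : \int[mu]_t (expR (b * t - expR g * expR t) * cos (tau * (t - k))) =
    expR (- b * g) * (cos d * A + sin d * B).
  rewrite -[LHS]/(\int[mu]_t F t) -(Rintegral_shift (- g) F mF) AE BE.
  rewrite -(RintegralZl (cos d) measurableT i1) -(RintegralZl (sin d) measurableT i2).
  rewrite -RintegralD; [|by []|exact: (integrableZl measurableT (cos d) i1)
    |exact: (integrableZl measurableT (sin d) i2)].
  rewrite -RintegralZl; [|by []|]; last first.
    exact: (integrableD measurableT (integrableZl measurableT (cos d) i1)
      (integrableZl measurableT (sin d) i2)).
  apply: eq_Rintegral => t _; rewrite /F.
  have -> : tau * (t - g - k) = tau * t - d by rewrite /d; ring.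
  rewrite cosB (_ : b * (t - g) - expR g * expR (t - g) = - b * g + (b * t - 1 * expR t)).
    by rewrite expRD; ring.
  by rewrite (expRD t) expRN; field; rewrite gt_eqF ?expR_gt0.
rewrite normrM (ger0_norm (expR_ge0 _)); apply: ler_wpM2l; first exact: expR_ge0.
exact: norm_combo_le _ _ _ _ (cos2Dsin2 d).
Qed.

(** The rate x / 2 of the majorant comes from cosh t >= |t| / 2. *)
Lemma macdonaldKi_integrable (tau x : R) : 0 < x ->
  mu.-integrable [set: R] (EFin \o (fun t => expR (- x * cosh t) * cos (tau * t))).
Proof.
move=> x0.
have x20 : 0 < x / 2 by rewrite divr_gt0.
apply: (le_integrable _ _ _ (integrable_expRN_norm (x / 2) x20)) => //.
  by apply/measurable_EFinP; apply: continuous_measurable_fun; rewrite /cosh; cts.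
move=> t _; rewrite lee_fin normrM (ger0_norm (expR_ge0 _)) (ger0_norm (expR_ge0 _)).
apply: (@le_trans _ _ (expR (- x * cosh t))).
  by rewrite ler_piMr ?expR_ge0// ler_norml cos_geN1 cos_le1.
rewrite ler_expR /cosh.
have : `|t| <= expR t + expR (- t).
  rewrite ler_norml; have := expR_ge1Dx t; have := expR_ge1Dx (- t).
  have := expR_gt0 t; have := expR_gt0 (- t) => *; apply/andP; split; lra.
move: (expR t + _) => e he; nra.
Qed.

Lemma macdonaldKiE (tau x : R) : 0 < x ->
  \int[mu]_t (expR (- x * cosh t) * cos (tau * t)) = 2 * macdonaldKi tau x.
Proof.
move=> x0; pose f t := expR (- x * cosh t) * cos (tau * t).
have fi := macdonaldKi_integrable tau x x0.
have mf : measurable_fun [set: R] f.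
  by apply: continuous_measurable_fun; rewrite /f /cosh; cts.
have fN t : f (- t) = f t.
  by rewrite /f /cosh opprK mulrN cosN addrC.
have mK : \int[mu]_(t in `]-oo, 0[) f t = macdonaldKi tau x.
  rewrite Rintegral_mkcond -Rintegral_opp; last first.
    by apply/(measurable_restrictT _ _).1 => //; exact: measurable_funTS.
  transitivity (\int[mu]_(t in `]0, +oo[) f t); last first.
    by apply: Rintegral_itv_obnd_cbnd; exact: integrableS fi.
  rewrite [RHS]Rintegral_mkcond; apply: eq_Rintegral => t _; rewrite !patchE fN.
  by congr (if _ then _ else _); apply/idP/idP => /set_mem/=; rewrite in_itv/= => h;
    rewrite mem_set//= in_itv/= ?andbT; move: h; rewrite ?andbT ?oppr_lt0.
rewrite -[LHS]/(\int[mu]_t f t) mulr_natl mulr2n -{1}mK /macdonaldKi -/f.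
rewrite -Rintegral_setU//; last 2 first.
- apply: integrableS fi => //; exact: measurableU.
- rewrite disj_set2E; apply/eqP; rewrite -subset0 => t [] /=.
  by rewrite !in_itv/= andbT leNgt => ->.
congr (fine (integral _ _ _)); apply/seteqP; split => // t _ /=.
by rewrite !in_itv/= andbT; have [|] := ltP t 0; [left|right].
Qed.

End cGamma_and_macdonald.

(** * The Mellin identity for K_{i tau} and the final estimate *)

Section main_bound.
Context {R : realType}.
Notation mu := (@lebesgue_measure R).

(** The real part of exp (- i tau k) u^(b + i tau) exp (- u) at u = exp t, to be integrated against
    du / u = dt. *)
Definition mellin_weight (b tau k t : R) : R := expR (b * t - expR t) * cos (tau * (t - k)).

Lemma measurable_osc_mellin (a b tau k x : R) : 0 < a -> a <= 1 ->
  measurable_fun [set: R * R] (fun z : R * R =>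
    (mellin_weight b tau k z.1 * (expR (- (expR z.1 * z.2)) * osc a x z.2))%:E).
Proof.
move=> a0 a1; apply/measurable_EFinP; apply: measurable_funM.
  have m : measurable_fun [set: R] (mellin_weight b tau k).
    by apply: continuous_measurable_fun; rewrite /mellin_weight; cts.
  exact: (measurableT_comp m (@measurable_fst _ _ R R)).
apply: measurable_funM.
  apply: measurableT_comp => //; apply: measurableT_comp => //.
  apply: measurable_funM; last exact: measurable_snd.
  by apply: measurableT_comp => //; exact: measurable_fst.
exact: (measurableT_comp (measurable_osc a x a0 a1) (@measurable_snd _ _ R R)).
Qed.

(** Absolute values destroy the oscillation and leave Gamma(b). This crude bound serves to justify
    Fubini's theorem, where finiteness suffices. *)
Lemma integral_mellin_abs (b tau k s : R) : 0 < b -> 0 < s ->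
  (\int[mu]_t `|(mellin_weight b tau k t * expR (- (expR t * s)))%:E| <=
  (expR (- b * ln (1 + s)) * Gamma b)%:E)%E.
Proof.
move=> b0 s0; have s1 : 0 < 1 + s by rewrite addr_gt0.
have key (t : R) : `|mellin_weight b tau k t * expR (- (expR t * s))| <=
    expR (b * t - expR (ln (1 + s)) * expR t).
  have -> : expR (ln (1 + s)) = 1 + s by apply: lnK; rewrite posrE.
  rewrite /mellin_weight !normrM !(ger0_norm (expR_ge0 _)) mulrAC -expRD.
  rewrite (_ : b * t - expR t + _ = b * t - (1 + s) * expR t); last by ring.
  by rewrite ler_piMr ?expR_ge0// ler_norml cos_geN1 cos_le1.
rewrite -(integral_expR_expR b _ b0); apply: ge0_le_integral => //.
- apply: measurableT_comp => //; apply/measurable_EFinP.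
  by apply: continuous_measurable_fun; rewrite /mellin_weight; cts.
- by apply/measurable_EFinP; apply: continuous_measurable_fun; cts.
- by move=> t _; rewrite lee_fin; exact: key.
Qed.

Lemma measurable_beta_integrand (c d : R) :
  measurable_fun [set: R] (fun s => expR (c * ln s - d * ln (1 + s))).
Proof.
apply: measurableT_comp => //; apply: measurable_funB; apply: measurable_funM => //.
by apply: measurableT_comp; [exact: measurable_ln|exact: measurable_funD].
Qed.

(** The factor 2^(a - 1) of the pointwise bound on [osc] cancels the 2^(1 - a) in the value of the
    Beta integral. *)
Lemma osc_beta_bound (a b x : R) : 0 < a -> a <= 1 -> 0 < x -> b = a + 1 / 2 ->
  (\int[mu]_s (`|osc a x s| * expR (- b * ln (1 + s)))%:E <=
  (Num.sqrt pi * expR (- a * ln x) * Gamma a ^+ 2 / Gamma b)%:E)%E.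
Proof.
move=> a0 a1 x0 bE.
pose C := expR ((a - 1) * ln 2) * expR (- a * ln x) * Gamma a.
have C0 : 0 <= C by rewrite !mulr_ge0 ?expR_ge0// ltW// Gamma_gt0.
have ln2 : (Num.sqrt pi * expR (- a * ln x) * Gamma a ^+ 2 / Gamma b)%:E =
    (C%:E * (expR (- a * ln 2) * (2 * Num.sqrt pi) * Gamma a / Gamma (a + 1 / 2))%:E)%E.
  rewrite -EFinM -bE /C; congr (_%:E).
  have e2 : expR ((a - 1) * ln 2) * expR (- a * ln 2) * 2 = 1 :> R.
    have {3}-> : 2 = expR (ln 2) :> R by rewrite lnK// posrE.
    rewrite -!expRD [X in expR X](_ : _ = 0) ?expR0//; by move: (ln 2) => l; ring.
  transitivity (expR ((a - 1) * ln 2) * expR (- a * ln 2) * 2 *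
    (Num.sqrt pi * expR (- a * ln x) * Gamma a ^+ 2 / Gamma b)); last by ring.
  by rewrite e2 mul1r.
rewrite ln2 -(integral_beta a a0) -ge0_integralZl_EFin; [|by []| | |exact: C0]; first last.
- by apply/measurable_EFinP; apply: measurable_funTS; exact: measurable_beta_integrand.
- by move=> s _; rewrite lee_fin expR_ge0.
rewrite [leRHS]integral_mkcond; apply: ge0_le_integral => //.
- apply/measurable_EFinP; apply: measurable_funM.
    by apply: measurableT_comp => //; exact: measurable_osc.
  apply: measurableT_comp => //; apply: measurable_funM => //.
  apply: measurableT_comp; first exact: measurable_ln.
  exact: measurable_funD.
- apply/(measurable_restrictT _ _).1 => //; apply: measurable_funeM; apply/measurable_EFinP.
  by apply: measurable_funTS; exact: measurable_beta_integrand.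
move=> s _; rewrite patchE; case: ifPn => [/set_mem/=|/negP sn]; last first.
  rewrite osc_le0 ?normr0 ?mul0r// leNgt; apply/negP => s0; apply: sn.
  by rewrite mem_set//= in_itv/= s0.
rewrite in_itv/= andbT => s0; rewrite -EFinM lee_fin.
have := osc_bound a x s a0 a1 x0 s0.
have -> : expR ((a - 1) * (ln 2 + ln s / 2)) * expR (- a * ln x) * Gamma a =
    C * expR ((a - 1) / 2 * ln s).
  rewrite /C mulrDr expRD (_ : (a - 1) * (ln s / 2) = (a - 1) / 2 * ln s); last by ring.
  by ring.
rewrite expRD -bE mulNr mulrA => h.
by rewrite ler_wpM2r ?expR_ge0.
Qed.

Lemma integrable_osc_mellin (a b tau k x : R) : 0 < a -> a <= 1 -> 0 < x -> b = a + 1 / 2 ->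
  (mu \x mu)%E.-integrable [set: R * R] (fun z : R * R =>
    (mellin_weight b tau k z.1 * (expR (- (expR z.1 * z.2)) * osc a x z.2))%:E).
Proof.
move=> a0 a1 x0 bE; have b0 : 0 < b by rewrite bE; lra.
apply/integrable21ltyP; first exact: measurable_osc_mellin.
apply: (@le_lt_trans _ _ ((Gamma b)%:E *
    \int[mu]_s (`|osc a x s| * expR (- b * ln (1 + s)))%:E)%E); last first.
  apply: (@le_lt_trans _ _ ((Gamma b)%:E *
     (Num.sqrt pi * expR (- a * ln x) * Gamma a ^+ 2 / Gamma b)%:E)%E).
    by apply: lee_wpmul2l; [rewrite lee_fin ltW// Gamma_gt0|exact: osc_beta_bound].
  by rewrite -EFinM ltry.
have mo : measurable_fun [set: R] (fun s => (`|osc a x s| * expR (- b * ln (1 + s)))%:E).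
  apply/measurable_EFinP; apply: measurable_funM.
    by apply: measurableT_comp => //; exact: measurable_osc.
  apply: measurableT_comp => //; apply: measurable_funM => //.
  apply: measurableT_comp; first exact: measurable_ln.
  exact: measurable_funD.
rewrite -ge0_integralZl_EFin; [|by []| |exact: mo|exact/ltW/Gamma_gt0]; last first.
  by move=> s _; rewrite lee_fin mulr_ge0 ?expR_ge0.
apply: ge0_le_integral => //.
- by move=> s _; apply: integral_ge0.
- apply: (measurable_fun_fubini_tonelli_G (m1 := mu) (fun z : R * R =>
    `|(mellin_weight b tau k z.1 * (expR (- (expR z.1 * z.2)) * osc a x z.2))%:E|%E)) => //.
  by apply: measurableT_comp => //; exact: measurable_osc_mellin.
- exact: measurable_funeM.
move=> s _; have [s0|s0] := leP s 0.
  rewrite integral0_eq; last by move=> t _ /=; rewrite osc_le0// !mulr0 normr0.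
  by rewrite -EFinM lee_fin !mulr_ge0 ?expR_ge0// ltW// Gamma_gt0.
apply: (@le_trans _ _ (\int[mu]_t (`|osc a x s|%:E *
    `|(mellin_weight b tau k t * expR (- (expR t * s)))%:E|))%E).
  rewrite le_eqVlt; apply/orP; left; apply/eqP; apply: eq_integral => t _ /=.
  by rewrite -EFinM -normrM; congr (`|_|%:E); ring.
rewrite ge0_integralZl_EFin; [|by []|by []| |by []]; last first.
  apply: measurableT_comp => //; apply/measurable_EFinP.
  by apply: continuous_measurable_fun; rewrite /mellin_weight; cts.
apply: (@le_trans _ _ (`|osc a x s|%:E * (expR (- b * ln (1 + s)) * Gamma b)%:E)%E).
  by apply: lee_wpmul2l; [rewrite lee_fin|exact: integral_mellin_abs].
by rewrite -!EFinM lee_fin le_eqVlt; apply/orP; left; apply/eqP; ring.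
Qed.

(** With b = a + 1/2 the powers of exp t cancel, leaving exp (- exp t - x^2 / (4 exp t)). This is
    symmetric about t = ln (x / 2), and translation to that centre gives exp (- x cosh t) and cos
    (tau t). *)
Lemma integral_mellin_laplace_osc (a tau x : R) : 0 < a -> a <= 1 -> 0 < x ->
  \int[mu]_t (mellin_weight (a + 1 / 2) tau (ln (x / 2)) t *
    \int[mu]_s (expR (- (expR t * s)) * osc a x s)) =
  Num.sqrt pi * Gamma a * macdonaldKi tau x.
Proof.
move=> a0 a1 x0; set k := ln (x / 2).
have ek : expR k = x / 2 by rewrite lnK// posrE divr_gt0.
pose c := Gamma a * Num.sqrt pi / 2.
pose f t := expR (- expR t - x ^+ 2 / (4 * expR t)) * cos (tau * (t - k)).
transitivity (\int[mu]_t (c * f t)).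
  apply: eq_Rintegral => t _; rewrite laplace_osc// /mellin_weight /f /c.
  have e1 : expR ((a + 1 / 2) * t) * (expR (- a * t) / expR (t / 2)) = 1.
    by rewrite -expRN -!expRD [X in expR X](_ : _ = 0) ?expR0//; field.
  rewrite !expRD.
  transitivity (expR ((a + 1 / 2) * t) * (expR (- a * t) / expR (t / 2)) *
    (Gamma a * Num.sqrt pi / 2 * (expR (- expR t) * expR (- (x ^+ 2 / (4 * expR t))) *
    cos (tau * (t - k))))); first by ring.
  by rewrite e1 mul1r.
pose h t := expR (- x * cosh t) * cos (tau * t).
have hf t : f (t + k) = h t.
  rewrite /f /h addrK expRD ek /cosh expRN; congr (expR _ * _).
  by field; rewrite !gt_eqF ?expR_gt0.
have mcf : measurable_fun [set: R] (fun t => c * f t).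
  apply: continuous_measurable_fun; rewrite /f; cts; rewrite gt_eqF// mulr_gt0// expR_gt0//.
rewrite -(Rintegral_shift k _ mcf).
transitivity (\int[mu]_t (c * h t)); first by apply: eq_Rintegral => t _; rewrite hf.
rewrite RintegralZl//; last exact: macdonaldKi_integrable.
by rewrite macdonaldKiE// /c; field.
Qed.

Lemma macdonaldKi_le (a tau x : R) : 0 < a -> a <= 1 -> 0 < x ->
  `|macdonaldKi tau x| <= Gamma a / Gamma (a + 1 / 2) *
    ComplexField.Normc.normc (cGamma ((a + 1 / 2) +i* tau)) * expR (- a * ln x).
Proof.
move=> a0 a1 x0; set b := a + 1 / 2; set N := ComplexField.Normc.normc _.
have b0 : 0 < b by rewrite /b; lra.
have Ga0 := Gamma_gt0 a a0; have Gb0 := Gamma_gt0 b b0.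
have sp0 : 0 < Num.sqrt pi :> R by rewrite sqrtr_gt0 pi_gt0.
have N0 : 0 <= N by rewrite /N; case: (cGamma _) => ? ?; exact: sqrtr_ge0.
pose k := ln (x / 2).
suff key : `|\int[mu]_t (mellin_weight b tau k t * \int[mu]_s (expR (- (expR t * s)) * osc a x s))|
    <= N * (Num.sqrt pi * expR (- a * ln x) * Gamma a ^+ 2 / Gamma b).
  move: key; rewrite integral_mellin_laplace_osc// normrM (gtr0_norm (mulr_gt0 sp0 Ga0)).
  move: (Gamma a) (Gamma b) (Num.sqrt pi) `|macdonaldKi tau x| Ga0 Gb0 sp0.
  move=> ga gb sp m ga0 gb0 sp0.
  rewrite -ler_pdivlMl ?mulr_gt0// => /le_trans; apply.
  rewrite le_eqVlt; apply/orP; left; apply/eqP.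
  by field; rewrite !gt_eqF.
have i := integrable_osc_mellin a b tau k x a0 a1 x0 erefl.
have inner t : (\int[mu]_s (mellin_weight b tau k t * (expR (- (expR t * s)) * osc a x s))%:E =
    (mellin_weight b tau k t * \int[mu]_s (expR (- (expR t * s)) * osc a x s))%:E)%E.
  have it : mu.-integrable [set: R] (fun s => (expR (- (expR t * s)) * osc a x s)%:E).
    apply: eq_integrable (integrable_fubini_F (integrable_osc_kernel a t x a0)) => // s _.
    exact: integral_osc_kernel.
  by rewrite [RHS]EFinM /Rintegral fineK ?integrable_fin_num// -integralZl.
have outer : mu.-integrable [set: R] (EFin \o (fun t =>
    mellin_weight b tau k t * \int[mu]_s (expR (- (expR t * s)) * osc a x s))).
  apply: eq_integrable (integrable_fubini_F i) => // t _; exact: inner.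
rewrite -lee_fin EFin_normr_Rintegral//.
have -> : (\int[mu]_t (mellin_weight b tau k t *
      \int[mu]_s (expR (- (expR t * s)) * osc a x s))%:E =
    \int[mu]_s \int[mu]_t (mellin_weight b tau k t * (expR (- (expR t * s)) * osc a x s))%:E)%E.
  by rewrite -(Fubini i)/=; apply: eq_integral => t _; rewrite inner.
have mG := measurable_fubini_G i.
(* Absolute values are taken in s alone, outside the t-integral, so the cancellation that produces
   |Gamma(b + i tau)| is kept. *)
apply: (le_trans (le_abse_integral _ _ _)) => //.
rewrite EFinM.
apply: (le_trans _ (lee_wpmul2l _ (osc_beta_bound a b x a0 a1 x0 erefl))); last first.
  by rewrite lee_fin.
have mo : measurable_fun [set: R] (fun s => (`|osc a x s| * expR (- b * ln (1 + s)))%:E).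
  apply/measurable_EFinP; apply: measurable_funM.
    by apply: measurableT_comp => //; exact: measurable_osc.
  apply: measurableT_comp => //; apply: measurable_funM => //.
  apply: measurableT_comp; first exact: measurable_ln.
  exact: measurable_funD.
rewrite -ge0_integralZl_EFin; [|by []| |exact: mo|exact: N0]; last first.
  by move=> s _; rewrite lee_fin mulr_ge0 ?expR_ge0.
apply: ge0_le_integral => //.
- exact: measurableT_comp.
- exact: measurable_funeM.
move=> s _; have [s0|s0] := leP s 0.
  rewrite integral0_eq; last by move=> t _ /=; rewrite osc_le0// !mulr0.
  by rewrite abse0 -EFinM lee_fin !mulr_ge0 ?expR_ge0.
have s1 : 0 < 1 + s by rewrite addr_gt0.
(* The factor exp (- s exp t) is absorbed into the weight, whose rate becomes 1 + s; its logarithm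
   is the [g] of [cGamma_scale_bound]. *)
pose G t := expR (b * t - expR (ln (1 + s)) * expR t) * cos (tau * (t - k)).
have iGs : mu.-integrable [set: R] (EFin \o G).
  apply: integrable_Gamma_trig; [exact: b0|exact: expR_gt0|by cts|].
  by move=> t; rewrite ler_norml cos_geN1 cos_le1.
have -> : (\int[mu]_t (mellin_weight b tau k t * (expR (- (expR t * s)) * osc a x s))%:E =
    (osc a x s * \int[mu]_t G t)%:E)%E.
  have eG : ((\int[mu]_t G t)%:E = \int[mu]_t (G t)%:E)%E.
    by rewrite fineK//; exact: integrable_fin_num.
  rewrite EFinM eG -integralZl//.
  have e1 : expR (ln (1 + s)) = 1 + s by apply: lnK; rewrite posrE.
  apply: eq_integral => t _; rewrite -EFinM /G /mellin_weight e1; congr (_%:E).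
  rewrite (_ : b * t - (1 + s) * expR t = b * t - expR t + - (expR t * s)); last by ring.
  by rewrite (expRD (b * t - expR t)); ring.
rewrite -EFinM lee_fin normrM mulrCA; apply: ler_wpM2l => //.
by rewrite mulrC; exact: cGamma_scale_bound.
Qed.

End main_bound.

Theorem mainTheorem6 (R : realType) (nu : R)
    (hnu_gt : - (1 / 2) < nu) (hnu_le : nu <= 1 / 2)
    (x tau : R) (hx : 0 < x) (htau : 0 < tau) :
  `|macdonaldKi tau x| <=
    Gamma (nu + 1 / 2) / Gamma (nu + 1)
      * ComplexField.Normc.normc (cGamma ((nu + 1) +i* tau))
      * x `^ (- nu - 1 / 2).
Proof.
have a0 : 0 < nu + 1 / 2 by lra.
have a1 : nu + 1 / 2 <= 1 by lra.
have := macdonaldKi_le (nu + 1 / 2) tau x a0 a1 hx.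
have -> : nu + 1 / 2 + 1 / 2 = nu + 1 by field.
by rewrite /powR gt_eqF// opprD.
Qed.
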